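(* Let $F$ be a Banach lattice. The following are equivalent: (i) $F^*$ is order continuous; (ii) the aw- and aaw-topologies coincide on $F$; (iii) the aw-topology is boundedly exhaustive; (iv) every bounded operator $T:F\to H$ (any Banach space $H$) which complements the aw-topology is $\infty$-DNS; (iv$'$) every bounded operator $T:F\to H$ which complements the aw-topology is DNS; (v) every closed subspace of $F$ on which the aw-topology agrees with the norm topology is $\infty$-dispersed; (v$'$) every closed subspace of $F$ on which the aw-topology agrees with the norm topology is dispersed; (vi) for no disjoint sequence of nonzero vectors does the aw-topology agree with the norm topology on its closed span.
   Context: $\mathrm{S}_F$ is the unit sphere; disjoint means $|f|\wedge|g|=0$. The absolute weak (aw-) topology: $f_p\to0$ iff $|f_p|\to0$ weakly, i.e. $\nu(|f_p|)\to0$ for all $\nu\in F^*$. $F^*_a$ is the order continuous part of $F^*$ (largest ideal on which the norm is order continuous); the aaw-topology: $f_p\to0$ iff $|f_p|\to0$ in $\sigma(F,F^*_a)$. A linear topology $\tau$ weaker than the norm topology is boundedly exhaustive if every norm-bounded disjoint sequence is $\tau$-null. $T$ complements $\tau$ if no net $(f_p)\subset\mathrm{S}_F$ is $\tau$-null with $\|Tf_p\|\to0$. $T$ is DNS if no disjoint $(f_n)\subset\mathrm{S}_F$ has $\|Tf_n\|\to0$ (equivalently its restriction to the closed span of any disjoint sequence is not strictly singular); $T$ is $\infty$-DNS if there is $r>0$ with $\liminf_n\|Tf_n\|>r$ for every disjoint $(f_n)\subset\mathrm{S}_F$. A closed subspace $E$ is dispersed if there is no $(e_n)\subset\mathrm{S}_E$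 and disjoint $(f_n)\subset F$ with $\|e_n-f_n\|\to0$ (equivalently $\liminf_n d(f_n,E)>0$ for every disjoint $(f_n)\subset\mathrm{S}_F$); $E$ is $\infty$-dispersed if there is $r>0$ with $\liminf_n d(f_n,E)>r$ for every disjoint $(f_n)\subset\mathrm{S}_F$. *)

(* Defs.v *)
From HB Require Import structures.
From mathcomp Require Import all_boot all_order all_algebra.
From mathcomp Require Import all_classical all_reals all_analysis.
Set Implicit Arguments. Unset Strict Implicit. Unset Printing Implicit Defensive.
Import Order.TTheory GRing.Theory Num.Theory.
Import numFieldNormedType.Exports.
Local Open Scope classical_set_scope.
Local Open Scope ring_scope.

Record banach_lattice (R : realType) (V : completeNormedModType R) := BanachLattice {
  bl_le : V -> V -> Prop;
  bl_sup : V -> V -> V;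
  bl_le_refl : forall x, bl_le x x;
  bl_le_antisym : forall x y, bl_le x y -> bl_le y x -> x = y;
  bl_le_trans : forall x y z, bl_le x y -> bl_le y z -> bl_le x z;
  bl_le_add : forall x y z, bl_le x y -> bl_le (x + z) (y + z);
  bl_le_scale : forall (a : R) x y, 0 <= a -> bl_le x y -> bl_le (a *: x) (a *: y);
  bl_sup_ubl : forall x y, bl_le x (bl_sup x y);
  bl_sup_ubr : forall x y, bl_le y (bl_sup x y);
  bl_sup_least : forall x y z, bl_le x z -> bl_le y z -> bl_le (bl_sup x y) z;
  bl_norm_mono : forall x y, bl_le (bl_sup x (- x)) (bl_sup y (- y)) -> `|x| <= `|y|
}.

Section BanachLatticeDefs.
Context {R : realType} {V : completeNormedModType R} (L : banach_lattice V).

Definition babs (x : V) : V := bl_sup L x (- x).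
Definition binf (x y : V) : V := - bl_sup L (- x) (- y).
Definition bdisjoint (x y : V) : Prop := binf (babs x) (babs y) = 0.
Definition disjoint_seq (f : nat -> V) : Prop :=
  forall n m, n <> m -> bdisjoint (f n) (f m).
Definition in_sphere (f : nat -> V) : Prop := forall n, `|f n| = 1.

Definition dual (phi : V -> R) : Prop :=
  (forall (a : R) x y, phi (a *: x + y) = a * phi x + phi y) /\ continuous phi.
Definition dual_le (phi psi : V -> R) : Prop :=
  forall x, bl_le L 0 x -> phi x <= psi x.
Definition dual_norm (phi : V -> R) : R :=
  sup [set `|phi x| | x in [set x : V | `|x| <= 1]].
Definition dual_directed_down (D : set (V -> R)) : Prop :=
  D `<=` dual /\ D !=set0 /\
  (forall phi psi, D phi -> D psi -> exists2 chi, D chi & dual_le chi phi /\ dual_le chi psi).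
Definition dual_inf_zero (D : set (V -> R)) : Prop :=
  (forall phi, D phi -> dual_le (fun=> 0) phi) /\
  (forall chi, dual chi -> (forall phi, D phi -> dual_le chi phi) -> dual_le chi (fun=> 0)).
Definition dual_order_continuous : Prop :=
  forall D, dual_directed_down D -> dual_inf_zero D ->
    forall e : R, 0 < e -> exists2 phi, D phi & dual_norm phi < e.
(* psi <= |phi| in F^*  (|phi| = sup(phi,-phi), least upper bound of phi,-phi) *)
Definition dual_below_abs (phi psi : V -> R) : Prop :=
  forall chi, dual chi -> dual_le phi chi -> dual_le (fun x => - phi x) chi ->
    dual_le psi chi.
Definition dual_a (phi : V -> R) : Prop :=
  dual phi /\
  forall D, dual_directed_down D -> dual_inf_zero D ->
    (forall psi, D psi -> dual_below_abs phi psi) ->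
    forall e : R, 0 < e -> exists2 psi, D psi & dual_norm psi < e.

Definition directed (I : Type) (le : I -> I -> Prop) : Prop :=
  inhabited I /\ (forall p, le p p) /\ (forall p q r, le p q -> le q r -> le p r) /\
  (forall p q, exists r, le p r /\ le q r).
Definition net_null (I : Type) (le : I -> I -> Prop) (u : I -> R) : Prop :=
  forall e : R, 0 < e -> exists p0, forall p, le p0 p -> `|u p| < e.
Definition aw_null (I : Type) (le : I -> I -> Prop) (f : I -> V) : Prop :=
  forall nu, dual nu -> net_null le (fun p => nu (babs (f p))).
Definition aaw_null (I : Type) (le : I -> I -> Prop) (f : I -> V) : Prop :=
  forall nu, dual_a nu -> net_null le (fun p => nu (babs (f p))).
Definition norm_null (I : Type) (le : I -> I -> Prop) (f : I -> V) : Prop :=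
  net_null le (fun p => `|f p|).

Definition aw_eq_aaw : Prop :=
  forall (I : Type) (le : I -> I -> Prop), directed le ->
    forall f : I -> V, aw_null le f <-> aaw_null le f.
Definition aw_boundedly_exhaustive : Prop :=
  forall f : nat -> V, disjoint_seq f -> (exists M : R, forall n, `|f n| <= M) ->
    aw_null (fun m n : nat => (m <= n)%N) f.

Definition bounded_op (H : normedModType R) (T : V -> H) : Prop :=
  (forall (a : R) x y, T (a *: x + y) = a *: T x + T y) /\ continuous T.
Definition complements_aw (H : normedModType R) (T : V -> H) : Prop :=
  forall (I : Type) (le : I -> I -> Prop), directed le ->
    forall f : I -> V, (forall p, `|f p| = 1) -> aw_null le f ->
      ~ net_null le (fun p => `|T (f p)|).
Definition DNS (H : normedModType R) (T : V -> H) : Prop :=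
  forall f : nat -> V, disjoint_seq f -> in_sphere f ->
    ~ ((fun n => `|T (f n)|) @ \oo --> (0 : R)).
Definition inf_DNS (H : normedModType R) (T : V -> H) : Prop :=
  exists2 r : R, 0 < r & forall f : nat -> V, disjoint_seq f -> in_sphere f ->
    (r%:E < limn_einf (fun n => (`|T (f n)|)%:E))%E.

Definition closed_subspace (E : set V) : Prop :=
  E 0 /\ (forall (a : R) x y, E x -> E y -> E (a *: x + y)) /\ closed E.
Definition aw_agrees_norm_on (E : set V) : Prop :=
  forall (I : Type) (le : I -> I -> Prop), directed le ->
    forall f : I -> V, (forall p, E (f p)) -> (aw_null le f <-> norm_null le f).
Definition dist_to (x : V) (E : set V) : R := inf [set `|x - e| | e in E].
Definition dispersed (E : set V) : Prop :=
  ~ exists (e f : nat -> V),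
      (forall n, E (e n)) /\ in_sphere e /\ disjoint_seq f /\
      (fun n => `|e n - f n|) @ \oo --> (0 : R).
Definition inf_dispersed (E : set V) : Prop :=
  exists2 r : R, 0 < r & forall f : nat -> V, disjoint_seq f -> in_sphere f ->
    (r%:E < limn_einf (fun n => (dist_to (f n) E)%:E))%E.
Definition lin_span (f : nat -> V) : set V :=
  [set x | exists (N : nat) (c : nat -> R), x = \sum_(i < N) c i *: f i].

End BanachLatticeDefs.

(* Main.v *)
Require Import Defs.
From HB Require Import structures.
From mathcomp Require Import all_boot all_order all_algebra.
From mathcomp Require Import all_classical all_reals all_analysis.
From mathcomp Require Import ring lra.
Set Implicit Arguments.
Unset Strict Implicit.
Unset Printing Implicit Defensive.
Import Order.TTheory GRing.Theory Num.Theory.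
Import numFieldNormedType.Exports.
Local Open Scope classical_set_scope.
Local Open Scope ring_scope.

(** The only deep implication is that the norm of the dual is order continuous
    once bounded disjoint sequences are aw-null.  If functionals decrease to 0
    but keep norm above [e], a gliding hump picks [phi_n] among them and
    [x_n >= 0] in the unit ball with [phi_n x_n > e / 2] and [phi_n] tiny on
    [x_0 + ... + x_(n-1)]; disjointifying the [x_n] yields a bounded disjoint
    sequence on which [phi_0] stays bounded below.

    If (iv) or (v) fails, weak nullity of disjoint sequences assembles unit
    vectors along which the operator norm or the distance to the subspace tends
    to 0 into an aw-null net, indexed by finite sets of functionals.

    The way back to (iii) uses the parts of a functional carried by the
    ideals generated by initial segments of a disjoint sequence.  Their tails
    have infimum 0, which makes bounded disjoint sequences null against [F^*_a].
    Conversely, if a bounded disjoint sequence is not aw-null, the differences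
    of these parts are the coordinates of a projection [P] of [F] onto a copy of
    l1 with [|P x| <= C mu |x|] for a positive functional [mu].  Then [id - P]
    complements the aw-topology but is not DNS, and the range of [P] is a
    disjoint closed span on which the aw- and norm topologies agree.  Hence (iv')
    gives (v) without any quotient space, and (vi) gives (i). *)

(** * Order calculus of a Banach lattice: modulus, positive part, disjointness, Riesz
    decomposition *)

Section VectorLattice.
Context {R : realType} {V : completeNormedModType R} (L : banach_lattice V).
Local Notation "x ⊑ y" := (bl_le L x y) (at level 70, no associativity).
Local Notation sup2 := (bl_sup L).
Local Notation "⟦ x ⟧" := (babs L x) (at level 0, format "⟦ x ⟧").

Lemma ble_trans (y x z : V) : x ⊑ y -> y ⊑ z -> x ⊑ z.
Proof. exact: bl_le_trans. Qed.

Lemma ble_antisym (x y : V) : x ⊑ y -> y ⊑ x -> x = y.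
Proof. exact: bl_le_antisym. Qed.

Lemma bleD (x y z t : V) : x ⊑ y -> z ⊑ t -> x + z ⊑ y + t.
Proof.
move=> xy zt; apply: (@ble_trans (y + z)); first exact: bl_le_add.
by rewrite ![y + _]addrC; exact: bl_le_add.
Qed.

Lemma ble_subr (x y z : V) : x + z ⊑ y <-> x ⊑ y - z.
Proof.
by split=> [/(bl_le_add (- z))|/(bl_le_add z)]; rewrite ?addrK ?subrK.
Qed.

Lemma ble_subl (x y z : V) : x - z ⊑ y <-> x ⊑ y + z.
Proof. by rewrite ble_subr opprK. Qed.

Lemma ble_sub0 (x y : V) : x ⊑ y <-> 0 ⊑ y - x.
Proof. by rewrite -ble_subr add0r. Qed.

Lemma bleN (x y : V) : x ⊑ y -> - y ⊑ - x.
Proof. by rewrite ble_sub0 => xy; apply/ble_sub0; rewrite opprK addrC. Qed.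

Lemma ble_addr (x y : V) : 0 ⊑ y -> x ⊑ x + y.
Proof. by move=> y0; apply/ble_sub0; rewrite addrAC subrr add0r. Qed.

Lemma bleD0 (x y : V) : 0 ⊑ x -> 0 ⊑ y -> 0 ⊑ x + y.
Proof. by move=> x0 y0; rewrite -[0]addr0; exact: bleD. Qed.

Lemma bleZ0 (a : R) (x : V) : 0 <= a -> 0 ⊑ x -> 0 ⊑ a *: x.
Proof. by move=> a0 x0; rewrite -(scaler0 _ a); exact: bl_le_scale. Qed.

Lemma bleZl (a b : R) (x : V) : 0 ⊑ x -> a <= b -> a *: x ⊑ b *: x.
Proof.
move=> x0 ab; apply/ble_sub0; rewrite -scalerBl.
by apply: bleZ0; rewrite // subr_ge0.
Qed.

Lemma bsum0 (I : Type) (r : seq I) (F : I -> V) :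
  (forall i, 0 ⊑ F i) -> 0 ⊑ \sum_(i <- r) F i.
Proof.
move=> F0; elim/big_ind: _ => //; [exact: bl_le_refl|exact: bleD0].
Qed.

Lemma babs_ub (x : V) : x ⊑ ⟦x⟧. Proof. exact: bl_sup_ubl. Qed.
Lemma babs_ubN (x : V) : - x ⊑ ⟦x⟧. Proof. exact: bl_sup_ubr. Qed.

Lemma babs_le (x z : V) : ⟦x⟧ ⊑ z <-> x ⊑ z /\ - x ⊑ z.
Proof.
split=> [xz|[xz nxz]]; last exact: bl_sup_least.
by split; apply: ble_trans xz; [exact: babs_ub|exact: babs_ubN].
Qed.

(** Adding the bounds of [x] and [- x] gives [0 ⊑ ⟦x⟧ + ⟦x⟧], which is then halved. *)
Lemma babs_ge0 (x : V) : 0 ⊑ ⟦x⟧.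
Proof.
have h : (2^-1 : R) *: (x - x) ⊑ 2^-1 *: (⟦x⟧ + ⟦x⟧).
  apply: bl_le_scale; first by rewrite invr_ge0.
  by apply: bleD; [exact: babs_ub|exact: babs_ubN].
have e : ⟦x⟧ + ⟦x⟧ = (2 : R) *: ⟦x⟧ by rewrite scaler_nat mulr2n.
by rewrite subrr scaler0 e scalerA mulVf ?scale1r// pnatr_eq0 in h.
Qed.

Lemma babsN (x : V) : ⟦- x⟧ = ⟦x⟧.
Proof.
apply: ble_antisym; apply/babs_le; rewrite ?opprK; split;
  first [exact: babs_ub|exact: babs_ubN|rewrite -{1}[x]opprK; exact: babs_ubN].
Qed.

Lemma babs_pos (x : V) : 0 ⊑ x -> ⟦x⟧ = x.
Proof.
move=> x0; apply: ble_antisym; last exact: babs_ub.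
apply/babs_le; split; first exact: bl_le_refl.
by apply: ble_trans (x0); rewrite -oppr0; apply: bleN.
Qed.

Lemma babs_idem (x : V) : ⟦⟦x⟧⟧ = ⟦x⟧.
Proof. by apply: babs_pos; exact: babs_ge0. Qed.

Lemma babs0 : ⟦0⟧ = 0. Proof. by apply: babs_pos; exact: bl_le_refl. Qed.

Lemma babsD (x y : V) : ⟦x + y⟧ ⊑ ⟦x⟧ + ⟦y⟧.
Proof.
apply/babs_le; split; first by apply: bleD; exact: babs_ub.
by rewrite opprD; apply: bleD; exact: babs_ubN.
Qed.

Lemma babsZ_ge0 (a : R) (x : V) : 0 <= a -> ⟦a *: x⟧ ⊑ a *: ⟦x⟧.
Proof.
move=> a0; apply/babs_le; rewrite -scalerN.
by split; apply: bl_le_scale => //; [exact: babs_ub|exact: babs_ubN].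
Qed.

Lemma babsZ (a : R) (x : V) : ⟦a *: x⟧ ⊑ `|a| *: ⟦x⟧.
Proof.
have [a0|a0] := leP 0 a; first by rewrite ger0_norm//; exact: babsZ_ge0.
rewrite ltr0_norm// -babsN -scaleNr; apply: babsZ_ge0.
by rewrite oppr_ge0 ltW.
Qed.

Lemma babs_eq0 (x : V) : ⟦x⟧ ⊑ 0 -> x = 0.
Proof.
move/babs_le => [x0 nx0]; apply: ble_antisym (x0) _.
by rewrite -[x]opprK -oppr0; apply: bleN.
Qed.

Lemma norm_babs (x : V) : `|⟦x⟧| = `|x|.
Proof.
have h (y z : V) : ⟦y⟧ = ⟦z⟧ -> `|y| <= `|z|.
  move=> e; apply: (bl_norm_mono (b := L)).
  by rewrite -/(babs L _) -/(babs L z) e; apply: bl_le_refl.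
by apply/eqP; rewrite eq_le !h// babs_idem.
Qed.

Lemma norm_mono (x y : V) : ⟦x⟧ ⊑ ⟦y⟧ -> `|x| <= `|y|.
Proof. exact: bl_norm_mono. Qed.

Lemma norm_mono_pos (x y : V) : 0 ⊑ x -> x ⊑ y -> `|x| <= `|y|.
Proof.
move=> x0 xy; apply: norm_mono; rewrite !babs_pos//.
exact: ble_trans xy.
Qed.

Lemma babsB_le (x y : V) : ⟦⟦x⟧ - ⟦y⟧⟧ ⊑ ⟦x - y⟧.
Proof.
have h (u v : V) : ⟦u⟧ - ⟦v⟧ ⊑ ⟦u - v⟧.
  by apply/ble_subr; rewrite opprK; rewrite -{1}[u](subrK v); exact: babsD.
by apply/babs_le; split; rewrite ?opprB//; rewrite -[X in _ ⊑ X]babsN opprB.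
Qed.

Lemma norm_babsB (x y : V) : `|⟦x⟧ - ⟦y⟧| <= `|x - y|.
Proof. by apply: norm_mono; exact: babsB_le. Qed.

Definition bpos (x : V) : V := sup2 x 0.

Lemma bpos_ge0 x : 0 ⊑ bpos x. Proof. exact: bl_sup_ubr. Qed.
Lemma bpos_ub x : x ⊑ bpos x. Proof. exact: bl_sup_ubl. Qed.
Lemma bpos_least x z : x ⊑ z -> 0 ⊑ z -> bpos x ⊑ z.
Proof. exact: bl_sup_least. Qed.

Lemma bpos_le_abs x : bpos x ⊑ ⟦x⟧.
Proof. by apply: bpos_least; [exact: babs_ub|exact: babs_ge0]. Qed.

Lemma bpos_dec x : x = bpos x - bpos (- x).
Proof.
apply: ble_antisym.
  apply/ble_subr; rewrite addrC; apply/ble_subr; apply: bpos_least.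
    by apply/ble_subr; rewrite addNr; exact: bpos_ge0.
  by rewrite -ble_sub0; exact: bpos_ub.
apply/ble_subr; rewrite opprK; apply: bpos_least.
  by rewrite -{1}[x]addr0; apply: bleD; [exact: bl_le_refl|exact: bpos_ge0].
by have := bpos_ub (- x); rewrite ble_sub0 opprK addrC.
Qed.

Lemma norm_bpos x : `|bpos x| <= `|x|.
Proof.
rewrite -(norm_babs x); apply: norm_mono_pos; first exact: bpos_ge0.
exact: bpos_le_abs.
Qed.

(* For positive u and v this is u ∧ v = 0. *)
Definition bperp (u v : V) : Prop := forall z, z ⊑ u -> z ⊑ v -> z ⊑ 0.

Lemma bperp_sym u v : bperp u v -> bperp v u.
Proof. by move=> uv z zv zu; exact: uv. Qed.

Lemma bperp_le u u' v v' : u' ⊑ u -> v' ⊑ v -> bperp u v -> bperp u' v'.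
Proof.
by move=> uu vv uv z zu zv; apply: uv; [apply: ble_trans uu|apply: ble_trans vv].
Qed.

(** For [z] below [u + v] and [w], the vector [z - v] lies below [u] and [w], so [z ⊑ v]; the second
    disjointness finishes. *)
Lemma bperpD u v w : 0 ⊑ v -> bperp u w -> bperp v w -> bperp (u + v) w.
Proof.
move=> v0 uw vw z zuv zw; apply: (vw) => //; apply/ble_sub0.
rewrite -oppr0 -opprB; apply: bleN; apply: uw; first by apply/ble_subr; rewrite opprK.
apply: ble_trans zw; apply/ble_subr; rewrite opprK; exact: ble_addr.
Qed.

(** A factor at most 1 only shrinks [u]. For [a > 1] the vector [z] is divided by [a] instead, and
    [a^-1 *: v ⊑ v]. *)
Lemma bperpZ (a : R) u v : 0 <= a -> 0 ⊑ u -> 0 ⊑ v -> bperp u v ->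
  bperp (a *: u) v.
Proof.
move=> a0 u0 v0 uv.
have [a1|a1] := leP a 1.
  apply: bperp_le uv; last exact: bl_le_refl.
  by rewrite -{2}(scale1r u); exact: bleZl.
have ap : 0 < a by apply: lt_trans a1.
move=> z zu zv; rewrite -[z](scalerKV (a := a)) ?gt_eqF// -(scaler0 _ a).
apply: bl_le_scale => //; apply: uv.
  by rewrite -(scalerK (a := a) _ u) ?gt_eqF//; apply: bl_le_scale; rewrite // invr_ge0.
apply: (@ble_trans (a^-1 *: v)); first by apply: bl_le_scale; rewrite // invr_ge0.
by rewrite -{2}(scale1r v); apply: bleZl => //; rewrite invf_le1// ltW.
Qed.

(** For [z] below both parts, [bpos (- x) - z] still bounds [- x] and 0 from above, so leastness of
    [bpos (- x)] forces [z ⊑ 0]. *)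
Lemma bperp_pos (x : V) : bperp (bpos x) (bpos (- x)).
Proof.
move=> z z1 z2; suff : bpos (- x) ⊑ bpos (- x) - z.
  by move/ble_subr; rewrite addrC => /ble_subr; rewrite subrr.
apply: bpos_least; last by rewrite -ble_sub0.
apply/ble_subr; rewrite addrC; apply/ble_subr; rewrite opprK.
by rewrite [X in _ + X]bpos_dec addrC subrK.
Qed.

Lemma bdisjointP x y : bdisjoint L x y <-> bperp ⟦x⟧ ⟦y⟧.
Proof.
rewrite /bdisjoint /binf; split=> [e z zx zy|h].
  rewrite -[z]opprK -e; apply: bleN; apply: bl_sup_least; exact: bleN.
apply: ble_antisym.
  by apply: h; rewrite -[X in _ ⊑ X]opprK; apply: bleN; [exact: bl_sup_ubl|exact: bl_sup_ubr].
rewrite -oppr0; apply: bleN; apply: bl_sup_least; rewrite -oppr0; apply: bleN; exact: babs_ge0.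
Qed.

(* The witness is (y ∧ x1) ∨ (- x1). *)
Lemma riesz_dec (y x1 x2 : V) : 0 ⊑ x1 -> 0 ⊑ x2 -> ⟦y⟧ ⊑ x1 + x2 ->
  exists y1, [/\ ⟦y1⟧ ⊑ x1, ⟦y - y1⟧ ⊑ x2 & ⟦y1⟧ ⊑ ⟦y⟧].
Proof.
move=> p1 p2 /babs_le [h1 h2].
pose m := - sup2 (- y) (- x1).
have my : m ⊑ y by rewrite -[y]opprK; apply: bleN; exact: bl_sup_ubl.
have mx : m ⊑ x1 by rewrite -[x1]opprK; apply: bleN; exact: bl_sup_ubr.
have mg z : z ⊑ y -> z ⊑ x1 -> z ⊑ m.
  by move=> zy zx; rewrite -[z]opprK; apply: bleN; apply: bl_sup_least; apply: bleN.
pose y1 := sup2 m (- x1).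
have nx1 : - x1 ⊑ 0 by rewrite -oppr0; apply: bleN.
have ny : - ⟦y⟧ ⊑ y by rewrite -[X in _ ⊑ X]opprK; apply: bleN; exact: babs_ubN.
have n0 : - ⟦y⟧ ⊑ 0 by rewrite -oppr0; apply: bleN; exact: babs_ge0.
have A1 : ⟦y1⟧ ⊑ x1.
  apply/babs_le; split.
    by apply: bl_sup_least => //; apply: ble_trans p1.
  by rewrite -[x1]opprK; apply: bleN; exact: bl_sup_ubr.
have A2 : ⟦y1⟧ ⊑ ⟦y⟧.
  apply/babs_le; split.
    apply: bl_sup_least; first by apply: ble_trans my _; exact: babs_ub.
    by apply: ble_trans nx1 _; exact: babs_ge0.
  rewrite -[⟦y⟧]opprK; apply: bleN.
  apply: (@ble_trans m); last exact: bl_sup_ubl.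
  by apply: mg => //; apply: ble_trans p1.
have A3 : ⟦y - y1⟧ ⊑ x2.
  apply/babs_le; split.
    apply/ble_subl; rewrite addrC; apply/ble_subl.
    apply: (@ble_trans m); last exact: bl_sup_ubl.
    by apply: mg; apply/ble_subl => //; exact: ble_addr.
  rewrite opprB; apply/ble_subl; apply: bl_sup_least.
    by apply: ble_trans my _; rewrite addrC; exact: ble_addr.
  rewrite addrC; apply/ble_subl; rewrite -[X in _ ⊑ X]opprK -opprD.
  exact: bleN.
by exists y1.
Qed.

End VectorLattice.

(** * Bounded linear functionals and the dual norm *)

Section LinearFunctionals.
Context {R : realType}.

Lemma lipschitz_linear_continuous (V W : normedModType R) (T : V -> W) (C : R) :
  (forall a x y, T (a *: x + y) = a *: T x + T y) ->
  (forall x, `|T x| <= C * `|x|) -> continuous T.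
Proof.
move=> lT bT x.
have TB u v : T u - T v = T (u - v).
  by rewrite addrC -scaleN1r -lT scaleN1r addrC.
apply/cvgrPdist_lt => e e0.
have C0 : 0 < `|C| + 1 by rewrite ltr_wpDl.
near=> y; rewrite TB; apply: le_lt_trans (bT _) _.
apply: (@le_lt_trans _ _ ((`|C| + 1) * `|x - y|)).
  by apply: ler_wpM2r => //; rewrite (le_trans (ler_norm C))// lerDl.
rewrite mulrC -ltr_pdivlMr//; near: y.
by apply: cvgr_dist_lt => //; exact: divr_gt0.
Unshelve. all: by end_near. Qed.

Lemma dual_sub (V : completeNormedModType R) (phi psi : V -> R) :
  dual phi -> dual psi -> dual (fun x => phi x - psi x).
Proof.
move=> d1 d2; split; first by move=> a x y; rewrite d1.1 d2.1; ring.
by move=> x; apply: cvgB; [exact: d1.2|exact: d2.2].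
Qed.

Context {V : completeNormedModType R} (phi : V -> R) (phid : dual phi).

Lemma dual0 : phi 0 = 0.
Proof. by have := phid.1 1 0 0; rewrite scaler0 addr0 mul1r; lra. Qed.

Lemma dualD x y : phi (x + y) = phi x + phi y.
Proof. by have := phid.1 1 x y; rewrite scale1r mul1r. Qed.

Lemma dualZ a x : phi (a *: x) = a * phi x.
Proof. by have := phid.1 a x 0; rewrite addr0 dual0 addr0. Qed.

Lemma dualN x : phi (- x) = - phi x.
Proof. by rewrite -scaleN1r dualZ mulN1r. Qed.

Lemma dualB x y : phi (x - y) = phi x - phi y.
Proof. by rewrite dualD dualN. Qed.

Lemma dual_bounded : exists2 C : R, 0 < C & forall x, `|phi x| <= C * `|x|.
Proof.
have /cvgrPdist_lt/(_ 1 ltr01) := phid.2 0.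
rewrite dual0 => /nbhs_ballP [d /= d0 hd].
exists (2 / d); first by rewrite divr_gt0.
move=> x; have [->|x0] := eqVneq x 0; first by rewrite dual0 !normr0 mulr0.
have nx : 0 < `|x| by rewrite normr_gt0.
(* Rescaling [x] to norm [d / 2] puts it in the ball where [phi] is below 1; hence the constant
   [2 / d]. *)
have c0 : 0 < d / 2 / `|x| by rewrite !divr_gt0.
have := hd ((d / 2 / `|x|) *: x).
rewrite -ball_normE /ball_ /= !sub0r !normrN normrZ (gtr0_norm c0) divfK ?gt_eqF//.
rewrite dualZ normrM (gtr0_norm c0) => h.
have {}h := ltW (h _); rewrite -ler_pdivlMl// in h.
apply: le_trans (h _) _; first by lra.
by rewrite mulr1 !invfM !invrK -mulrA mulrCA mulrA mulrC.
Qed.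

Lemma dual_norm_le e : dual_norm phi < e ->
  forall x, `|x| <= 1 -> `|phi x| < e.
Proof.
move=> he x x1; apply: le_lt_trans he; have [C C0 hC] := dual_bounded.
apply: ub_le_sup; last by exists x.
exists C => _ [y /= y1 <-]; apply: le_trans (hC y) _.
by rewrite ler_piMr// ltW.
Qed.

Lemma dual_norm_gt e : e < dual_norm phi ->
  exists2 x, `|x| <= 1 & e < `|phi x|.
Proof.
move=> he; have [|_ [x /= x1 <-] ex] := sup_gt _ he; last by exists x.
by exists `|phi 0|, 0 => //=; rewrite normr0.
Qed.

End LinearFunctionals.

(** * Extension from the positive cone, and the parts of a functional carried by ideals *)

Section Kantorovich.
Context {R : realType} {V : completeNormedModType R} (L : banach_lattice V).
Local Notation "x ⊑ y" := (bl_le L x y) (at level 70, no associativity).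
Local Notation "⟦ x ⟧" := (babs L x) (at level 0, format "⟦ x ⟧").
Local Notation bpos := (bpos L).

Definition cone_ext (p : V -> R) (x : V) : R := p (bpos x) - p (bpos (- x)).

Lemma cone_extP (p : V -> R) (C : R) :
  (forall x y, 0 ⊑ x -> 0 ⊑ y -> p (x + y) = p x + p y) ->
  (forall a x, 0 <= a -> 0 ⊑ x -> p (a *: x) = a * p x) ->
  (forall x, 0 ⊑ x -> `|p x| <= C * `|x|) ->
  dual (cone_ext p) /\ forall x, 0 ⊑ x -> cone_ext p x = p x.
Proof.
move=> pD pZ pC.
(* The value does not depend on how [x] is written as a difference of positive vectors: [x = u - v]
   means [bpos x + v = u + bpos (- x)], to which additivity applies. *)
have key u v x : 0 ⊑ u -> 0 ⊑ v -> x = u - v -> cone_ext p x = p u - p v.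
  move=> u0 v0 xuv; rewrite /cone_ext.
  have e : bpos x + v = u + bpos (- x).
    have -> : bpos x = x + bpos (- x) by rewrite [X in X + _](bpos_dec L) subrK.
    by rewrite [X in X + _ + _]xuv addrAC subrK.
  have := congr1 p e; rewrite !pD//; try exact: bpos_ge0; lra.
have ext x : 0 ⊑ x -> cone_ext p x = p x.
  move=> x0; rewrite (key x 0)//; [|exact: bl_le_refl|by rewrite subr0].
  by rewrite -(scale0r (0 : V)) pZ// ?mul0r ?subr0//; exact: bl_le_refl.
have lin a x y : cone_ext p (a *: x + y) = a * cone_ext p x + cone_ext p y.
  have P z : 0 ⊑ bpos z := bpos_ge0 L z.
  have [a0|/ltW a0] := leP 0 a.
    rewrite (key (a *: bpos x + bpos y) (a *: bpos (- x) + bpos (- y))).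
    - by rewrite !pD ?pZ//; [rewrite /cone_ext; lra|exact: bleZ0..].
    - by apply: bleD0 => //; exact: bleZ0.
    - by apply: bleD0 => //; exact: bleZ0.
    - by rewrite {1}(bpos_dec L x) {1}(bpos_dec L y) scalerBr opprD addrACA.
  (* For negative [a] the positive and negative parts of [x] trade places. *)
  have na : 0 <= - a by rewrite oppr_ge0.
  rewrite (key (- a *: bpos (- x) + bpos y) (- a *: bpos x + bpos (- y))).
  - by rewrite !pD ?pZ//; [rewrite /cone_ext; lra|exact: bleZ0..].
  - by apply: bleD0 => //; exact: bleZ0.
  - by apply: bleD0 => //; exact: bleZ0.
  - rewrite {1}(bpos_dec L x) {1}(bpos_dec L y) scalerBr opprD [RHS]addrACA.
    by rewrite !scaleNr !opprK [a *: _ - _]addrC.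
split=> //; split=> //.
(* One [|C|] for each part of [x]; the absolute value is there because [C] carries no sign
   condition. *)
apply: (@lipschitz_linear_continuous _ V R^o (cone_ext p) (`|C| + `|C|)) => // x.
have h z : `|p (bpos z)| <= `|C| * `|z|.
  apply: le_trans (pC _ (bpos_ge0 L z)) _.
  apply: (@le_trans _ _ (`|C| * `|bpos z|)); first by rewrite ler_wpM2r// ler_norm.
  by rewrite ler_wpM2l// norm_bpos.
rewrite mulrDl; apply: le_trans (ler_normB _ _) _; apply: lerD => //.
by rewrite -(normrN x).
Qed.

Definition lattice_ideal (J : V -> Prop) : Prop :=
  [/\ J 0, forall x y, J x -> J y -> J (x + y),
      forall (a : R) x, J x -> J (a *: x) & forall x y, J y -> ⟦x⟧ ⊑ ⟦y⟧ -> J x].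

(* On the positive cone this is the Riesz-Kantorovich formula for the modulus
   of [nu], with the test vectors confined to the ideal [J]. *)
Definition modulus_on (nu : V -> R) (J : V -> Prop) (x : V) : R :=
  sup [set nu y | y in [set y | J y /\ ⟦y⟧ ⊑ x]].

(** With [J] the whole space this is |nu|; for a smaller ideal it is the part of |nu| that [J]
    carries. *)
Definition modulus (nu : V -> R) (J : V -> Prop) : V -> R :=
  cone_ext (modulus_on nu J).

Section Modulus.
Context (nu : V -> R) (nud : dual nu) (J : V -> Prop) (idJ : lattice_ideal J).

Let J0 : J 0. Proof. by case: idJ. Qed.

Let JN x : J x -> J (- x).
Proof. by case: idJ => _ _ h _ /(h (-1)); rewrite scaleN1r. Qed.

Let mo_nonempty x : 0 ⊑ x -> [set nu y | y in [set y | J y /\ ⟦y⟧ ⊑ x]] !=set0.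
Proof. by move=> x0; exists (nu 0), 0 => //=; rewrite babs0. Qed.

Let mo_le x c : 0 ⊑ x -> (forall y, J y -> ⟦y⟧ ⊑ x -> nu y <= c) ->
  modulus_on nu J x <= c.
Proof.
move=> x0 h; apply: ge_sup; first exact: mo_nonempty.
by move=> _ [y [Jy yx] <-]; exact: h.
Qed.

Let mo_bound : exists2 C : R, 0 < C & forall x y, ⟦y⟧ ⊑ x -> nu y <= C * `|x|.
Proof.
have [C C0 hC] := dual_bounded nud; exists C => // x y yx.
apply: le_trans (ler_norm _) _; apply: le_trans (hC _) _.
rewrite ler_pM2l// -(norm_babs L y); apply: (norm_mono_pos (L := L)) => //.
exact: babs_ge0.
Qed.

Let mo_ub x y : J y -> ⟦y⟧ ⊑ x -> nu y <= modulus_on nu J x.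
Proof.
move=> Jy yx; have [C C0 hC] := mo_bound.
apply: ub_le_sup; last by exists y.
by exists (C * `|x|) => _ [z [_ zx] <-]; exact: hC.
Qed.

Let mo_adh x e : 0 ⊑ x -> 0 < e ->
  exists y, [/\ J y, ⟦y⟧ ⊑ x & modulus_on nu J x - e < nu y].
Proof.
move=> x0 e0; have [|_ [y [Jy yx] <-] h] := sup_gt (mo_nonempty x0) (x := modulus_on nu J x - e).
  by rewrite /modulus_on ltrBlDr ltrDl.
by exists y.
Qed.

(** Riesz decomposition splits a test vector for the sum, and the pieces stay in [J] because the
    first is dominated by the vector itself. Conversely near-optimal test vectors add up. *)
Let moD x1 x2 : 0 ⊑ x1 -> 0 ⊑ x2 ->
  modulus_on nu J (x1 + x2) = modulus_on nu J x1 + modulus_on nu J x2.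
Proof.
case: idJ => _ JD JZ Js p1 p2; apply/eqP; rewrite eq_le; apply/andP; split.
  apply: mo_le; first exact: bleD0.
  move=> y Jy yx; have [y1 [h1 h2 h3]] := riesz_dec p1 p2 yx.
  have Jy1 : J y1 by apply: Js h3.
  rewrite -(subrK y1 y) (dualD nud) addrC; apply: lerD; apply: mo_ub => //.
  by apply: JD => //; exact: JN.
apply/ler_addgt0Pr => e e0; have e2 : 0 < e / 2 by lra.
have [y1 [Jy1 yx1 h1]] := mo_adh p1 e2.
have [y2 [Jy2 yx2 h2]] := mo_adh p2 e2.
have : nu (y1 + y2) <= modulus_on nu J (x1 + x2).
  apply: mo_ub; first exact: JD.
  by apply: ble_trans (babsD _ _ _) _; exact: bleD.
by rewrite (dualD nud); lra.
Qed.

Let mo_norm x : 0 ⊑ x -> 0 <= modulus_on nu J x.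
Proof.
by move=> x0; rewrite -(dual0 nud); apply: mo_ub => //; rewrite babs0.
Qed.

Let moZ (a : R) x : 0 <= a -> 0 ⊑ x ->
  modulus_on nu J (a *: x) = a * modulus_on nu J x.
Proof.
case: idJ => _ JD JZ Js; rewrite le_eqVlt => /orP[/eqP <-|].
  move=> _; rewrite scale0r mul0r; apply/eqP; rewrite eq_le mo_norm ?andbT; last exact: bl_le_refl.
  apply: mo_le; first exact: bl_le_refl.
  by move=> y _ /babs_eq0 ->; rewrite (dual0 nud).
(* One inequality for all positive scalars is enough: the reverse one is this one for the inverse
   scalar. *)
have half b z : 0 < b -> 0 ⊑ z -> modulus_on nu J (b *: z) <= b * modulus_on nu J z.
  move=> b0 z0; apply: mo_le; first by apply: bleZ0 => //; exact: ltW.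
  move=> y Jy yz; rewrite -ler_pdivrMl// -(dualZ nud); apply: mo_ub; first exact: JZ.
  apply: ble_trans (babsZ_ge0 _ _ _) _; first by rewrite invr_ge0 ltW.
  rewrite -[z](scalerK (a := b)) ?gt_eqF//; apply: bl_le_scale => //.
  by rewrite invr_ge0 ltW.
move=> a0 x0; apply/eqP; rewrite eq_le half//=.
rewrite -ler_pdivlMl//; rewrite -{1}[x](scalerK (a := a)) ?gt_eqF//.
by apply: half; rewrite ?invr_gt0//; apply: bleZ0 => //; exact: ltW.
Qed.

Let mo_ext :
  dual (modulus nu J) /\ forall x, 0 ⊑ x -> modulus nu J x = modulus_on nu J x.
Proof.
have [C C0 hC] := mo_bound; apply: (@cone_extP _ C moD moZ) => x x0.
by rewrite ger0_norm ?mo_norm//; apply: mo_le => // y _; exact: hC.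
Qed.

Lemma modulus_dual : dual (modulus nu J). Proof. exact: mo_ext.1. Qed.

Lemma modulus_le x c : 0 ⊑ x -> (forall y, J y -> ⟦y⟧ ⊑ x -> nu y <= c) ->
  modulus nu J x <= c.
Proof. by move=> x0; rewrite mo_ext.2//; exact: mo_le. Qed.

Lemma modulus_ub x y : 0 ⊑ x -> J y -> ⟦y⟧ ⊑ x -> nu y <= modulus nu J x.
Proof. by move=> x0; rewrite mo_ext.2//; exact: mo_ub. Qed.

Lemma modulus_approx x e : 0 ⊑ x -> 0 < e ->
  exists y, [/\ J y, ⟦y⟧ ⊑ x & modulus nu J x - e < nu y].
Proof. by move=> x0; rewrite mo_ext.2//; exact: mo_adh. Qed.

Lemma modulus_ge0 x : 0 ⊑ x -> 0 <= modulus nu J x.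
Proof. by move=> x0; rewrite mo_ext.2//; exact: mo_norm. Qed.

Lemma modulus_ge_norm x : 0 ⊑ x -> J x -> `|nu x| <= modulus nu J x.
Proof.
move=> x0 Jx; rewrite ler_norml lerNl -(dualN nud).
by apply/andP; split; apply: modulus_ub; rewrite ?babsN ?babs_pos//;
  [exact: JN|exact: bl_le_refl|exact: bl_le_refl].
Qed.

Lemma modulus_eq0 x : 0 ⊑ x -> (forall y, J y -> ⟦y⟧ ⊑ x -> y = 0) ->
  modulus nu J x = 0.
Proof.
move=> x0 h; apply/eqP; rewrite eq_le modulus_ge0// andbT.
by apply: modulus_le => // y Jy yx; rewrite (h y)// (dual0 nud).
Qed.

End Modulus.

Lemma modulus_subset nu J K x : dual nu -> lattice_ideal J -> lattice_ideal K ->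
  (forall y, J y -> K y) -> 0 ⊑ x -> modulus nu J x <= modulus nu K x.
Proof.
move=> nud iJ iK JK x0; apply: modulus_le => // y Jy yx.
by apply: modulus_ub => //; exact: JK.
Qed.

Lemma modulus_pos_id nu J x : dual nu -> lattice_ideal J ->
  (forall y, 0 ⊑ y -> 0 <= nu y) -> 0 ⊑ x -> J x -> modulus nu J x = nu x.
Proof.
move=> nud iJ nu0 x0 Jx; apply/eqP; rewrite eq_le; apply/andP; split.
  apply: modulus_le => // y _ yx; rewrite -subr_ge0 -(dualB nud); apply: nu0.
  by rewrite -ble_sub0; apply: ble_trans yx; exact: babs_ub.
by apply: le_trans (ler_norm _) _; exact: modulus_ge_norm.
Qed.

End Kantorovich.

(** * Ideals generated by initial segments of a disjoint sequence *)

Section DisjointSequences.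
Context {R : realType} {V : completeNormedModType R} (L : banach_lattice V).
Local Notation "x ⊑ y" := (bl_le L x y) (at level 70, no associativity).
Local Notation "⟦ x ⟧" := (babs L x) (at level 0, format "⟦ x ⟧").

(** The vector [u + v - x] lies below both [u] and [v], hence below 0. *)
Lemma bperp_addl_le u v x : bperp L u v -> u ⊑ x -> v ⊑ x -> u + v ⊑ x.
Proof.
move=> uv ux vx; rewrite -[x]add0r; apply/ble_subl; apply: uv; apply/ble_subl.
  by apply: bleD => //; exact: bl_le_refl.
by rewrite addrC; apply: bleD => //; exact: bl_le_refl.
Qed.

Lemma bpos_add_le x : bpos L x + bpos L (- x) ⊑ ⟦x⟧.
Proof.
apply: bperp_addl_le; first exact: bperp_pos.
  exact: bpos_le_abs.
by rewrite -babsN; exact: bpos_le_abs.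
Qed.

Definition gen_ideal (u y : V) : Prop := exists2 k : R, 0 <= k & ⟦y⟧ ⊑ k *: u.

Lemma gen_idealP u : 0 ⊑ u -> lattice_ideal L (gen_ideal u).
Proof.
move=> u0; split.
- by exists 0 => //; rewrite scale0r babs0; exact: bl_le_refl.
- move=> x y [k k0 xk] [l l0 yl]; exists (k + l); first exact: addr_ge0.
  by rewrite scalerDl; apply: ble_trans (babsD _ _ _) _; exact: bleD.
- move=> a x [k k0 xk]; exists (`|a| * k); first exact: mulr_ge0.
  rewrite -scalerA; apply: ble_trans (babsZ _ _ _) _.
  exact: bl_le_scale.
- by move=> x y [k k0 yk] xy; exists k => //; apply: ble_trans yk.
Qed.

Lemma gen_ideal_perp u v y : 0 ⊑ u -> bperp L u v -> gen_ideal u y ->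
  ⟦y⟧ ⊑ v -> y = 0.
Proof.
move=> u0 uv [k k0 yk] yv; apply: (@babs_eq0 _ _ L).
apply: (bperpZ k0 u0 _ uv) => //.
by apply: ble_trans yv; exact: babs_ge0.
Qed.

Context (f : nat -> V).

Definition psum (N : nat) : V := \sum_(i < N) ⟦f i⟧.

Lemma psum_ge0 N : 0 ⊑ psum N.
Proof. by apply: bsum0 => i; exact: babs_ge0. Qed.

Lemma psumS N : psum N.+1 = psum N + ⟦f N⟧.
Proof. by rewrite /psum big_ord_recr. Qed.

Lemma psum_le N M : (N <= M)%N -> psum N ⊑ psum M.
Proof.
elim: M => [|M IH]; first by rewrite leqn0 => /eqP ->; exact: bl_le_refl.
rewrite leq_eqVlt => /orP[/eqP ->|]; first exact: bl_le_refl.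
rewrite ltnS psumS => /IH h; apply: ble_trans h _; apply: ble_addr.
exact: babs_ge0.
Qed.

Lemma babs_le_psum n N : (n < N)%N -> ⟦f n⟧ ⊑ psum N.
Proof.
move=> nN; apply: ble_trans (psum_le nN); rewrite psumS addrC.
by apply: ble_addr; exact: psum_ge0.
Qed.

Definition head_ideal (N : nat) : V -> Prop := gen_ideal (psum N).
Definition seq_ideal (y : V) : Prop := exists N, head_ideal N y.

Lemma head_idealP N : lattice_ideal L (head_ideal N).
Proof. exact: gen_idealP (psum_ge0 N). Qed.

Lemma head_ideal_le N M y : (N <= M)%N -> head_ideal N y -> head_ideal M y.
Proof.
move=> NM [k k0 yk]; exists k => //; apply: ble_trans yk _.
by apply: bl_le_scale => //; exact: psum_le.
Qed.

Lemma seq_idealP : lattice_ideal L seq_ideal.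
Proof.
split.
- by exists 0%N; case: (head_idealP 0).
- move=> x y [N xN] [M yM]; exists (maxn N M).
  have [_ h _ _] := head_idealP (maxn N M).
  by apply: h; [apply: head_ideal_le xN|apply: head_ideal_le yM];
    rewrite ?leq_maxl ?leq_maxr.
- by move=> a x [N xN]; exists N; have [_ _ h _] := head_idealP N; exact: h.
- by move=> x y [N yN] xy; exists N; have [_ _ _ h] := head_idealP N; exact: h xy.
Qed.

Lemma head_ideal_mem n N : (n < N)%N -> head_ideal N ⟦f n⟧.
Proof.
by move=> nN; exists 1 => //; rewrite scale1r babs_idem; exact: babs_le_psum.
Qed.

Context (df : disjoint_seq L f).

Lemma psum_perp N n : (N <= n)%N -> bperp L (psum N) ⟦f n⟧.
Proof.
elim: N => [_|N IH Nn]; first by rewrite /psum big_ord0 => z.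
rewrite psumS; apply: bperpD; [exact: babs_ge0|exact/IH/ltnW|].
by apply/bdisjointP; apply: df; apply/eqP; rewrite ltn_eqF.
Qed.

(** The generator sums only [⟦f i⟧] with [i < N], so it is disjoint from [f n], and 0 is the only
    test vector below [⟦f n⟧]. *)
Lemma modulus_head_eq0 nu N n : dual nu -> (N <= n)%N ->
  modulus L nu (head_ideal N) ⟦f n⟧ = 0.
Proof.
move=> nud Nn; apply: modulus_eq0 => //; [exact: head_idealP|exact: babs_ge0|].
by move=> y; apply: gen_ideal_perp; [exact: psum_ge0|exact: psum_perp].
Qed.

(* [D] consists of the tails [modulus nu seq_ideal - modulus nu (head_ideal N)],
   which decrease to 0 below |nu| and dominate [nu] on [f n] for [n >= N]. *)
Lemma dual_a_disjoint_null nu : dual_a L nu ->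
  (exists M : R, forall n, `|f n| <= M) ->
  net_null (fun m n : nat => (m <= n)%N) (fun n => nu ⟦f n⟧).
Proof.
move=> [nud nua] [M fM] e e0.
have dH N : dual (modulus L nu (head_ideal N)) by apply: modulus_dual => //; exact: head_idealP.
have dS : dual (modulus L nu seq_ideal) by apply: modulus_dual => //; exact: seq_idealP.
pose psi N x := modulus L nu seq_ideal x - modulus L nu (head_ideal N) x.
have dpsi N : dual (psi N) by exact: dual_sub.
pose D := [set psi N | N in [set: nat]].
(* [M] may be 0, so [M + 1] serves as the divisor. *)
have M0 : 0 < M + 1 by apply: ltr_wpDl => //; apply: le_trans (fM 0%N).
have eM : 0 < e / (M + 1) by exact: divr_gt0.
have [||| _ [N _ <-] hN] := nua D _ _ _ _ eM.
- split; first by move=> _ [N _ <-].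
  split; first by exists (psi 0%N), 0%N.
  have anti N K : (N <= K)%N -> dual_le L (psi K) (psi N).
    move=> NK x x0; rewrite lerD2l lerN2; apply: modulus_subset => //; try exact: head_idealP.
    by move=> y; exact: head_ideal_le.
  move=> _ _ [N _ <-] [K _ <-]; exists (psi (maxn N K)); first by exists (maxn N K).
  by split; apply: anti; rewrite ?leq_maxl ?leq_maxr.
- split=> [_ [N _ <-] x x0|chi chid hchi x x0].
    rewrite subr_ge0; apply: modulus_subset => //; [exact: head_idealP|exact: seq_idealP|].
    by move=> y; exists N.
  (* A near-optimal test vector of the whole ideal already lies in some head ideal, so the
     corresponding tail is below [d] at [x]. *)
  apply/ler_addgt0Pr => d d0; rewrite add0r.
  have [y [[N yN] yx h]] := modulus_approx nud seq_idealP x0 d0.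
  have := hchi (psi N) (ex_intro2 _ _ N I erefl) x x0.
  by have := modulus_ub nud (head_idealP N) x0 yN yx; rewrite /psi; lra.
- move=> _ [N _ <-] chi chid h1 h2 x x0.
  have chi0 z : 0 ⊑ z -> 0 <= chi z by move=> z0; have := h1 z z0; have := h2 z z0; lra.
  apply: (@le_trans _ _ (modulus L nu seq_ideal x)).
    by rewrite gerBl; apply: modulus_ge0 => //; exact: head_idealP.
  apply: modulus_le => //; first exact: seq_idealP.
  (* Since [chi] bounds both [nu] and [- nu], [nu y] is at most [chi] of the sum of the two parts of
     [y], and that sum lies below [x]. *)
  move=> y _ yx; rewrite [y](bpos_dec L) (dualB nud).
  have p1 := h1 _ (bpos_ge0 L y); have p2 := h2 _ (bpos_ge0 L (- y)).
  have : 0 <= chi (x - (bpos L y + bpos L (- y))).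
    apply: chi0; rewrite -ble_sub0; apply: ble_trans yx; exact: bpos_add_le.
  by rewrite (dualB chid) (dualD chid); lra.
exists N => n Nn.
have z0 := babs_ge0 L (f n).
apply: (@le_lt_trans _ _ (psi N ⟦f n⟧)).
  rewrite /psi modulus_head_eq0// subr0; apply: modulus_ge_norm => //; first exact: seq_idealP.
  by exists n.+1; exact: head_ideal_mem.
have := @dual_norm_le _ _ _ (dpsi N) _ hN ((M + 1)^-1 *: ⟦f n⟧).
rewrite (dualZ (dpsi N)) normrZ norm_babs gtr0_norm ?invr_gt0//.
rewrite ler_pdivrMl// mulr1 normrM gtr0_norm ?invr_gt0// ltr_pdivrMl// mulrCA divff ?gt_eqF// mulr1.
by move=> h; apply: le_lt_trans (ler_norm _) (h _); apply: le_trans (fM n) _; rewrite lerDl.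
Qed.

End DisjointSequences.

(** * Aw-null nets of unit vectors extracted from disjoint sequences *)

Section Nets.
Context {R : realType} {V : completeNormedModType R} (L : banach_lattice V).
Local Notation "⟦ x ⟧" := (babs L x) (at level 0, format "⟦ x ⟧").

(** Otherwise the infimum of the tail from [N], and with it the lower limit, would be at least [d].
    The gap between [r] and [d] turns the weak inequality left by the negation into a strict one. *)
Lemma limn_einf_frequently (u : nat -> R) (r d : R) :
  ~ (r%:E < limn_einf (fun n => (u n)%:E))%E -> r < d ->
  forall N, exists2 n, (N <= n)%N & u n < d.
Proof.
move=> h rd N; apply: contrapT => h2; apply: h.
apply: (@lt_le_trans _ _ d%:E); first by rewrite lte_fin.
rewrite limn_einf_lim (cvg_lim (@ereal_hausdorff R) (@cvg_einfs_sup _ _)).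
apply: (@le_trans _ _ (einfs (fun n => (u n)%:E) N)).
  apply: le_ereal_inf_tmp => _ [n /= Nn <-]; rewrite lee_fin leNgt.
  by apply/negP => und; apply: h2; exists n.
by apply: ereal_sup_ubound; exists N.
Qed.

Lemma limn_einf_null (u : nat -> R) (r : R) : 0 < r ->
  (forall e, 0 < e -> exists N, forall n, (N <= n)%N -> u n < e) ->
  ~ (r%:E < limn_einf (fun n => (u n)%:E))%E.
Proof.
move=> r0 hu; rewrite limn_einf_lim (cvg_lim (@ereal_hausdorff R) (@cvg_einfs_sup _ _)).
apply/negP; rewrite -leNgt; apply: ge_ereal_sup => _ [N _ <-].
have [K hK] := hu r r0; apply: (@le_trans _ _ (u (maxn N K))%:E).
  by apply: ereal_inf_lbound; exists (maxn N K) => //=; rewrite leq_maxl.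
by rewrite lee_fin; apply/ltW/hK; rewrite leq_maxr.
Qed.

(** [Phi] will be the norm of an operator or the distance to a subspace. An index is a finite list
    of functionals with a precision [k]: some normalized disjoint sequence has lower limit of [Phi]
    at most [r k], all listed functionals are eventually small on its moduli, and a late term
    serves. *)
Lemma null_net_of_frequently (Phi : V -> R) : (forall x, 0 <= Phi x) ->
  aw_boundedly_exhaustive L ->
  ~ (exists2 r : R, 0 < r & forall f : nat -> V, disjoint_seq L f -> in_sphere f ->
    (r%:E < limn_einf (fun n => (Phi (f n))%:E))%E) ->
  exists (I : Type) (le : I -> I -> Prop) (f : I -> V) (g : I -> R),
    [/\ directed le, forall p, `|f p| = 1, aw_null L le f, net_null le g &
        forall p, Phi (f p) < g p].
Proof.
move=> Phi0 exh nh.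
pose r k : R := k.+1%:R^-1.
have r0 k : 0 < r k by rewrite invr_gt0 ltr0n.
have pick (p : seq (V -> R) * nat) : exists x : V,
    [/\ `|x| = 1, Phi x < 2 * r p.2 &
        forall nu, dual nu -> List.In nu p.1 -> `|nu ⟦x⟧| < r p.2].
  case: p => S k /=.
  have [f [df sf hf]] : exists f, [/\ disjoint_seq L f, in_sphere f &
      ~ ((r k)%:E < limn_einf (fun n => (Phi (f n))%:E))%E].
    apply: contrapT => h; apply: nh; exists (r k) => // f df sf.
    by apply: contrapT => hf; apply: h; exists f.
  have [N hN] : exists N, forall n, (N <= n)%N ->
      forall nu, dual nu -> List.In nu S -> `|nu ⟦f n⟧| < r k.
    elim: S => [|nu S [N hN]]; first by exists 0%N.
    (* Lists may contain functions outside the dual; these impose no condition. *)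
    have [dnu|ndnu] := pselect (dual nu); last first.
      by exists N => n Nn mu dmu [e|h]; [rewrite e in ndnu|exact: hN].
    have [|K hK] := exh f df _ nu dnu (r k) (r0 k).
      by exists 1 => n; rewrite sf.
    exists (maxn N K) => n; rewrite geq_max => /andP[Nn Kn] mu dmu [<-|h].
      exact: hK.
    exact: hN.
  have [|n Nn Pn] := limn_einf_frequently hf _ N (d := 2 * r k).
    by have := r0 k; lra.
  by exists (f n); split=> //; exact: hN.
have [g hg] := choice pick.
have rlt (d : R) : 0 < d -> exists k, forall l, (k <= l)%N -> 2 * r l < d.
  move=> d0; exists (Num.truncn (2 / d)) => l kl.
  rewrite ltr_pdivrMr ?ltr0n// mulrC -ltr_pdivrMr//.
  have := truncnS_gt (2 / d); move/lt_le_trans; apply.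
  by rewrite ler_nat ltnS.
pose le (p q : seq (V -> R) * nat) :=
  (forall nu, List.In nu p.1 -> List.In nu q.1) /\ (p.2 <= q.2)%N.
exists (seq (V -> R) * nat)%type, le, g, (fun p => 2 * r p.2); split.
- split; first exact: inhabits ([::], 0%N).
  split; first by move=> p; split.
  split; first by move=> p q s [h1 h2] [h3 h4]; split; [move=> nu /h1/h3|exact: leq_trans h4].
  move=> p q; exists (p.1 ++ q.1, maxn p.2 q.2).
  by split; split=> /=; rewrite ?leq_maxl ?leq_maxr// => nu h;
    apply: List.in_or_app; [left|right].
- by move=> p; case: (hg p).
- move=> nu dnu d d0; have [k hk] := rlt d d0.
  exists ([:: nu], k) => p [/= h1 h2]; have [_ _ h] := hg p.
  apply: lt_trans (h nu dnu (h1 nu _)) _; first by left.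
  by have := hk _ h2; have := r0 p.2; lra.
- move=> d d0; have [k hk] := rlt d d0.
  exists ([::], k) => p [/= _ h2].
  by rewrite gtr0_norm ?hk// mulr_gt0.
- by move=> p; case: (hg p).
Qed.

Lemma exhaustive_inf_DNS : aw_boundedly_exhaustive L ->
  forall (H : completeNormedModType R) (T : V -> H),
    bounded_op T -> complements_aw L T -> inf_DNS L T.
Proof.
move=> exh H T _ cT; apply: contrapT.
move/(null_net_of_frequently (fun x => normr_ge0 (T x)) exh) 
  => [I [le [f [g [dl sf af ng fg]]]]].
apply: cT dl _ sf af _ => d /ng [p0 hp]; exists p0 => p /hp.
by rewrite normr_id; apply: le_lt_trans; apply: le_trans (ltW (fg p)) (ler_norm _).
Qed.

Lemma dist_to_ge0 (x : V) (E : set V) : 0 <= dist_to x E.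
Proof.
(* For empty [E] the infimum takes the default value 0. *)
rewrite /dist_to; have [->|/set0P ne] := eqVneq [set `|x - e| | e in E] set0.
  by rewrite inf0.
by apply: lb_le_inf => // _ [e _ <-].
Qed.

Lemma dist_to_le (x e : V) (E : set V) : E e -> dist_to x E <= `|x - e|.
Proof. by move=> Ee; apply: ge_inf; [exists 0 => _ [y _ <-]|exists e]. Qed.

Lemma dist_to_approx (x : V) (E : set V) (d : R) : E !=set0 ->
  dist_to x E < d -> exists2 e, E e & `|x - e| < d.
Proof.
move=> [e0 Ee0]; case/inf_lt; first by exists `|x - e0|, e0.
by move=> _ [e Ee <-] h; exists e.
Qed.

(** Unit vectors [f p] forming an aw-null net and approaching [E] have approximants [e p] in [E].
    These are aw-null too, since the modulus is 1-Lipschitz, hence norm-null by agreement, against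
    [|f p| = 1]. *)
Lemma exhaustive_inf_dispersed : aw_boundedly_exhaustive L ->
  forall E : set V, closed_subspace E -> aw_agrees_norm_on L E -> inf_dispersed L E.
Proof.
move=> exh E cE aE; apply: contrapT.
move/(null_net_of_frequently (fun x => dist_to_ge0 x E) exh) 
  => [I [le [f [g [dl sf af ng fg]]]]].
have [E0 _] := cE.
have /choice [e he] p : exists e, E e /\ `|f p - e| < g p.
  by have [|e Ee h] := dist_to_approx _ (fg p); [exists 0|exists e].
have [_ [lerefl [letr ledir]]] := dl.
have ae : aw_null L le e.
  move=> nu dnu d d0; have [C C0 hC] := dual_bounded dnu.
  have d2 : 0 < d / 2 by lra.
  have [p1 h1] := af nu dnu _ d2.
  have [p2 h2] := ng _ (divr_gt0 d2 C0).
  have [p3 [l1 l2]] := ledir p1 p2.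
  exists p3 => p lp; have {}h1 := h1 p (letr _ _ _ l1 lp).
  have {}h2 := h2 p (letr _ _ _ l2 lp).
  rewrite -[⟦e p⟧](subrK ⟦f p⟧) (dualD dnu); apply: le_lt_trans (ler_normD _ _) _.
  suff : `|nu (⟦e p⟧ - ⟦f p⟧)| < d / 2 by lra.
  apply: le_lt_trans (hC _) _; rewrite mulrC -ltr_pdivlMr//.
  apply: le_lt_trans (norm_babsB _ _ _) _; rewrite distrC.
  by apply: lt_trans (he p).2 _; apply: le_lt_trans h2; exact: ler_norm.
have half : (0 : R) < 1 / 2 by lra.
have [p1 h1] := (aE _ le dl e (fun p => (he p).1)).1 ae _ half.
have [p2 h2] := ng _ half.
have [p [/h1 l1 /h2 l2]] := ledir p1 p2.
have := ler_normD (f p - e p) (e p); rewrite subrK sf.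
have := (he p).2; have := ler_norm (g p); rewrite normr_id in l1; lra.
Qed.

End Nets.

(** * The gliding hump: order continuity of the dual norm *)

Section OrderContinuity.
Context {R : realType} {V : completeNormedModType R} (L : banach_lattice V).
Local Notation "x ⊑ y" := (bl_le L x y) (at level 70, no associativity).
Local Notation "⟦ x ⟧" := (babs L x) (at level 0, format "⟦ x ⟧").
Local Notation bpos := (bpos L).

Lemma pos_dual_le (phi : V -> R) x y : dual phi ->
  dual_le L (fun=> 0) phi -> x ⊑ y -> phi x <= phi y.
Proof.
move=> dphi phi0 xy; rewrite -subr_ge0 -(dualB dphi); apply: phi0.
by rewrite -ble_sub0.
Qed.

Lemma pos_dual_abs (phi : V -> R) x : dual phi ->
  dual_le L (fun=> 0) phi -> `|phi x| <= phi ⟦x⟧.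
Proof.
move=> dphi phi0; rewrite ler_norml lerNl -(dualN dphi).
by apply/andP; split; apply: pos_dual_le => //; [exact: babs_ubN|exact: babs_ub].
Qed.

(* The pointwise infimum of [D] on the cone is additive because [D] is directed,
   so it extends to a functional lying below [D]. *)
Lemma dual_inf_zero_pointwise (D : set (V -> R)) : dual_directed_down L D ->
  dual_inf_zero L D -> forall x d, 0 ⊑ x -> 0 < d -> exists2 phi, D phi & phi x < d.
Proof.
move=> [Dd [[phi0 Dphi0] Ddir]] [Dpos Dinf].
pose p x := inf [set phi x | phi in D].
have ne x : [set phi x | phi in D] !=set0 by exists (phi0 x), phi0.
have p0 x : 0 ⊑ x -> 0 <= p x.
  by move=> x0; apply: lb_le_inf => // _ [phi Dphi <-]; exact: Dpos.
have ple x phi : 0 ⊑ x -> D phi -> p x <= phi x.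
  move=> x0 Dphi; apply: ge_inf; last by exists phi.
  by exists 0 => _ [psi Dpsi <-]; exact: Dpos.
have pap x d : 0 < d -> exists2 phi, D phi & phi x < p x + d.
  move=> d0; have [|_ [phi Dphi <-] h] := inf_lt (ne x) (x := p x + d); last by exists phi.
  by rewrite ltrDl.
have pD x y : 0 ⊑ x -> 0 ⊑ y -> p (x + y) = p x + p y.
  move=> x0 y0; have xy0 := bleD0 x0 y0; apply/eqP; rewrite eq_le; apply/andP; split;
    apply/ler_addgt0Pr => d d0.
    have d2 : 0 < d / 2 by lra.
    have [f Df hf] := pap x _ d2; have [g Dg hg] := pap y _ d2.
    have [h Dh [hf' hg']] := Ddir _ _ Df Dg.
    have := ple _ _ xy0 Dh; rewrite (dualD (Dd _ Dh)).
    by have := hf' x x0; have := hg' y y0; lra.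
  have [f Df hf] := pap (x + y) _ d0; rewrite (dualD (Dd _ Df)) in hf.
  by have := ple _ _ x0 Df; have := ple _ _ y0 Df; lra.
have pZ a x : 0 <= a -> 0 ⊑ x -> p (a *: x) = a * p x.
  rewrite le_eqVlt => /orP[/eqP <- x0|].
    rewrite scale0r mul0r; apply/eqP; rewrite eq_le p0 ?andbT; last exact: bl_le_refl.
    by rewrite -(dual0 (Dd _ Dphi0)); apply: ple => //; exact: bl_le_refl.
  have half b z : 0 < b -> 0 ⊑ z -> b * p z <= p (b *: z).
    move=> b0 z0; apply: lb_le_inf => // _ [f Df <-].
    by rewrite (dualZ (Dd _ Df)) ler_pM2l//; exact: ple.
  move=> a0 x0; apply/eqP; rewrite eq_le half// andbT.
  rewrite -ler_pdivrMl// -{2}[x](scalerK (a := a)) ?gt_eqF//.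
  by apply: half; rewrite ?invr_gt0//; apply: bleZ0 => //; exact: ltW.
have [C C0 hC] := dual_bounded (Dd _ Dphi0).
have [|cd ce] := @cone_extP _ _ L p C pD pZ.
  move=> x x0; rewrite ger0_norm ?p0//; apply: le_trans (ple _ _ x0 Dphi0) _.
  by apply: le_trans (ler_norm _) (hC x).
move=> x d x0 d0; have [phi Dphi h] := pap x d d0; exists phi => //.
apply: lt_le_trans h _; rewrite gerDr -ce//.
(* The extension of [p] is a lower bound of [D], so it is at most 0 on the cone. *)
by apply: (Dinf _ cd _ x x0) => psi Dpsi z z0; rewrite ce//; exact: ple.
Qed.

(** The positive part of [a - l] is dominated by [⟦u n - l⟧] for [n >= N], whose norm tends to 0. *)
Lemma ble_lim (u : nat -> V) (l a : V) N : u @ \oo --> l ->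
  (forall n, (N <= n)%N -> a ⊑ u n) -> a ⊑ l.
Proof.
move=> ul au; suff e0 : bpos (a - l) = 0.
  by have := bpos_ub L (a - l); rewrite e0 => /ble_subl; rewrite add0r.
apply/eqP; rewrite -normr_le0; apply/ler_addgt0Pr => d d0; rewrite add0r.
have /cvgrPdist_lt/(_ d d0) [K _ hK] := ul.
have := hK (maxn N K) (leq_maxr _ _) => /ltW /= h; apply: le_trans h.
rewrite distrC -(norm_babs L (u _ - l)).
apply: (norm_mono_pos (L := L)); first exact: bpos_ge0.
apply: bpos_least; last exact: babs_ge0.
apply: (ble_trans _ (babs_ub L _)); apply: bleD; last exact: bl_le_refl.
by apply: au; rewrite leq_maxl.
Qed.

(** The series of the terms [2^-1 ^+ n *: x n] converges absolutely. Its sum dominates each term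
    because the partial sums past that term do. *)
Lemma geometric_half_sum (x : nat -> V) : (forall n, 0 ⊑ x n) ->
  (forall n, `|x n| <= 1) ->
  exists w, forall n, (2^-1 : R) ^+ n *: x n ⊑ w.
Proof.
move=> x0 x1; pose z (n : nat) : V := (2^-1 : R) ^+ n *: x n.
have z0 n : 0 ⊑ z n by apply: bleZ0 => //; apply: exprn_ge0; rewrite invr_ge0.
have cz : cvgn (series z).
  apply: normed_cvg; apply: (@series_le_cvg _ _ (geometric 1 2^-1)).
  - by move=> n /=.
  - by move=> n /=; rewrite mul1r exprn_ge0// invr_ge0.
  - move=> n /=; rewrite mul1r normrZ ger0_norm ?exprn_ge0 ?invr_ge0//.
    by rewrite ler_piMr// exprn_ge0// invr_ge0.
  - by apply: is_cvg_geometric_series; rewrite ger0_norm ?invr_ge0//; lra.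
exists (limn (series z)) => n; apply: (ble_lim (N := n.+1) cz) => m nm.
rewrite /series /= (bigD1_seq n) ?iota_uniq//=; last by rewrite mem_index_iota.
by apply: ble_addr; rewrite big_mkcond/=; apply: bsum0 => i; case: ifP => // _; exact: bl_le_refl.
Qed.

(* For n < m the n-th and m-th terms lie below multiples of the negative and
   positive parts of [t x_m - x_n], where [t = 2^-(n+m)]. *)
Lemma disjointify (x s : nat -> V) (w : V) : (forall n, 0 ⊑ x n) ->
  (forall n, 0 ⊑ s n) -> (forall n m, (n < m)%N -> x n ⊑ s m) ->
  (forall n, (2^-1 : R) ^+ n *: x n ⊑ w) ->
  disjoint_seq L
    (fun n => bpos (x n - ((4 : R) ^+ n *: s n + (2^-1 : R) ^+ n *: w))).
Proof.
move=> x0 s0 xs xw.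
have h0 n : 0 <= (2^-1 : R) ^+ n by apply: exprn_ge0; rewrite invr_ge0.
have w0 : 0 ⊑ w by apply: ble_trans (xw 0%N); exact: bleZ0.
pose y n := bpos (x n - ((4 : R) ^+ n *: s n + (2^-1 : R) ^+ n *: w)).
have py n : ⟦y n⟧ = y n by apply: babs_pos; exact: bpos_ge0.
suff main n m : (n < m)%N -> bperp L (y n) (y m).
  move=> n m nm; apply/bdisjointP; rewrite !py.
  by have [/main|/main/bperp_sym|] := ltngtP n m.
move=> nm; pose t : R := 2^-1 ^+ (n + m); pose a := t *: x m - x n.
have t0 : 0 < t by apply: exprn_gt0; rewrite invr_gt0.
have yn : y n ⊑ bpos (- a).
  apply: bpos_least; last exact: bpos_ge0.
  apply: (ble_trans _ (bpos_ub L _)); rewrite opprB.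
  apply: bleD; first exact: bl_le_refl.
  apply: bleN; rewrite -[X in X ⊑ _]add0r; apply: bleD.
    by apply: bleZ0 => //; exact: exprn_ge0.
  (* Here [t *: x m] is [2^-n] times [2^-m *: x m], and the latter lies below [w]. *)
  by rewrite /t exprD -scalerA; apply: bl_le_scale.
have ym : y m ⊑ t^-1 *: bpos a.
  apply: bpos_least; last by apply: bleZ0; [rewrite invr_ge0 ltW|exact: bpos_ge0].
  apply: (@ble_trans _ _ _ (t^-1 *: a)); last first.
    by apply: bl_le_scale; [rewrite invr_ge0 ltW|exact: bpos_ub].
  rewrite /a scalerBr scalerK ?gt_eqF//; apply: bleD; first exact: bl_le_refl.
  apply: bleN; rewrite -[X in X ⊑ _]addr0; apply: bleD; last exact: bleZ0.
  (* The factor [4 ^+ m] is chosen to absorb [t^-1 = 2 ^+ (n + m)] for every [n < m]. *)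
  apply: (@ble_trans _ _ _ ((4 : R) ^+ m *: x n)).
    apply: bleZl => //; rewrite /t exprVn invrK.
    have -> : (4 : R) = 2 ^+ 2 by rewrite expr2; lra.
    by rewrite -exprM ler_eXn2l ?ltr1n// mul2n -addnn leq_add2r ltnW.
  by apply: bl_le_scale; [exact: exprn_ge0|exact: xs].
apply: (bperp_le yn ym); apply: bperp_sym; apply: bperpZ.
- by rewrite invr_ge0 ltW.
- exact: bpos_ge0.
- exact: bpos_ge0.
- exact: bperp_pos.
Qed.

Lemma exhaustive_order_continuous :
  aw_boundedly_exhaustive L -> dual_order_continuous L.
Proof.
move=> exh D Ddown Dinf e e0; apply: contrapT => nD.
have [Dd [[phi0 Dphi0] Ddir]] := Ddown; have [Dpos _] := Dinf.
have pw := dual_inf_zero_pointwise Ddown Dinf.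
(* [X phi] is a positive vector of the unit ball almost norming [phi]; off [D] it is 0 by
   default. *)
have /choice [X hX] phi : exists x, D phi ->
    [/\ 0 ⊑ x, `|x| <= 1 & e / 2 < phi x].
  have [Dphi|] := pselect (D phi); last by exists 0.
  have [|x x1 hx] := @dual_norm_gt _ _ phi (e / 2).
    apply: (@lt_le_trans _ _ e); first by lra.
    by rewrite leNgt; apply/negP => h; apply: nD; exists phi.
  exists ⟦x⟧ => _; split; [exact: babs_ge0|by rewrite norm_babs|].
  by apply: lt_le_trans hx _; apply: pos_dual_abs; [exact: Dd|exact: Dpos].
(* The tolerance cancels the factor [4 ^+ n] in front of [s n], leaving [e / 8]. *)
pose dl n : R := e / 8 / 4 ^+ n.
have dl0 n : 0 < dl n by rewrite !divr_gt0// exprn_gt0.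
have /choice [N hN] (q : (V -> R) * V * nat) : exists psi, D q.1.1 -> 0 ⊑ q.1.2 ->
    [/\ D psi, dual_le L psi q.1.1 & psi q.1.2 < dl q.2].
  case: q => [[phi s] n] /=.
  have [[Dphi s0]|h] := pselect (D phi /\ 0 ⊑ s); last by exists phi => h1 h2; case: h.
  have [f Df hf] := pw s (dl n) s0 (dl0 n).
  have [g Dg [g1 g2]] := Ddir _ _ Dphi Df.
  by exists g => _ _; split=> //; apply: le_lt_trans (g2 s s0) hf.
(* The state pairs [phi n] with [s n = x 0 + ... + x (n-1)]; the next functional lies below [phi n]
   and is small on the new sum. *)
pose st := fix st n : (V -> R) * V := if n is k.+1 then
  let s := (st k).2 + X (st k).1 in (N ((st k).1, s, n), s) else (phi0, 0).
pose phi n := (st n).1; pose s n := (st n).2; pose x n := X (phi n).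
have inv n : [/\ D (phi n), 0 ⊑ s n & phi n (s n) < dl n].
  elim: n => [|n [Dn sn _]].
    by split=> //; [exact: bl_le_refl|rewrite /phi /s /= (dual0 (Dd _ Dphi0))].
  have [xn _ _] := hX _ Dn; have sx : 0 ⊑ s n + x n by exact: bleD0.
  by have [h1 h2 h3] := hN (phi n, s n + x n, n.+1) Dn sx.
have Dn n : D (phi n) by case: (inv n).
have sn n : 0 ⊑ s n by case: (inv n).
have xn n : 0 ⊑ x n by case: (hX _ (Dn n)).
have x1 n : `|x n| <= 1 by case: (hX _ (Dn n)).
have phi_le n : dual_le L (phi n) phi0.
  elim: n => [|n IH] z z0; first exact: lexx.
  have sx : 0 ⊑ s n + x n by exact: bleD0.
  have [_ h _] := hN (phi n, s n + x n, n.+1) (Dn n) sx.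
  by apply: le_trans (h z z0) (IH z z0).
have sS m : s m.+1 = s m + x m by [].
have xs n m : (n < m)%N -> x n ⊑ s m.
  elim: m => // m IH; rewrite ltnS leq_eqVlt => /orP[/eqP ->|/IH h].
    by rewrite sS addrC; exact: ble_addr.
  by apply: ble_trans h _; rewrite sS; exact: ble_addr.
have [w hw] := geometric_half_sum xn x1.
have dy := disjointify xn sn xs hw.
set y := (fun n => _) in dy.
have h0 n : 0 <= (2^-1 : R) ^+ n by apply: exprn_ge0; rewrite invr_ge0.
have w0 : 0 ⊑ w by apply: ble_trans (hw 0%N); exact: bleZ0.
have y0 n : 0 ⊑ y n by exact: bpos_ge0.
have e8 : 0 < e / 8 by lra.
have [|K hK] := exh y dy _ phi0 (Dd _ Dphi0) _ e8.
  exists 1 => n; apply: le_trans (x1 n); apply: (norm_mono_pos (L := L)) => //.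
  apply: bpos_least => //; apply/ble_subl; apply: ble_addr; apply: bleD0; exact: bleZ0.
have [K' _ hK'] : \forall n \near \oo, `|geometric (phi0 w) 2^-1 n| < e / 8.
  apply: (cvgr0Pnorm_lt _).1 e8.
  by apply: cvg_geometric; rewrite ger0_norm ?invr_ge0//; lra.
pose n := maxn K K'.
have := hK n (leq_maxl _ _); rewrite babs_pos// => /(le_lt_trans (ler_norm _)) h1.
have /(le_lt_trans (ler_norm _)) /= h2 := hK' n (leq_maxr _ _).
have h3 := phi_le n _ (y0 n).
have h4 : phi n (x n - ((4 : R) ^+ n *: s n + (2^-1 : R) ^+ n *: w)) <= phi n (y n).
  by apply: pos_dual_le; [exact: Dd|exact: Dpos|exact: bpos_ub].
have dn := Dd _ (Dn n).
rewrite (dualB dn) (dualD dn) !(dualZ dn) in h4.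
have [_ _ h5] := inv n; have [_ _ h6] := hX _ (Dn n); rewrite -/(x n) in h6.
have h7 : 4 ^+ n * phi n (s n) <= e / 8.
  by rewrite -ler_pdivlMl ?exprn_gt0// mulrC ltW.
have h8 : 2^-1 ^+ n * phi n w <= phi0 w * 2^-1 ^+ n.
  by rewrite mulrC ler_wpM2r//; exact: phi_le.
(* The lower bound [e / 2 - e / 8 - e / 8] for [phi n (y n)] contradicts
   [phi n (y n) <= phi0 (y n) < e / 8]. *)
lra.
Qed.

End OrderContinuity.

(** * A projection onto a copy of l1 when a bounded disjoint sequence is not aw-null *)

Section Projection.
Context {R : realType} {V : completeNormedModType R} (L : banach_lattice V).
Local Notation "x ⊑ y" := (bl_le L x y) (at level 70, no associativity).
Local Notation "⟦ x ⟧" := (babs L x) (at level 0, format "⟦ x ⟧").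

Lemma bdisjoint_scale_abs (a b : R) x y : 0 <= a -> 0 <= b -> bdisjoint L x y ->
  bdisjoint L (a *: ⟦x⟧) (b *: ⟦y⟧).
Proof.
have P z : 0 ⊑ ⟦z⟧ := babs_ge0 L z.
move=> a0 b0 /bdisjointP xy; apply/bdisjointP.
rewrite (babs_pos (bleZ0 a0 (P x))) (babs_pos (bleZ0 b0 (P y))).
apply: bperpZ => //; first exact: bleZ0.
by apply: bperp_sym; apply: bperpZ => //; exact: bperp_sym.
Qed.

(** A subsequence keeps [nu] away from 0 on the moduli; [nu] is replaced by |nu| and the moduli are
    normalized. As their norms are at most [M], the lower bound becomes [e / M]. Such a sequence
    behaves like the unit vector basis of l1. *)
Lemma not_exhaustive_l1 : ~ aw_boundedly_exhaustive L ->
  exists (f : nat -> V) (mu : V -> R) (eps : R),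
    [/\ disjoint_seq L f, in_sphere f, forall n, 0 ⊑ f n,
        dual mu /\ dual_le L (fun=> 0) mu &
        0 < eps /\ forall n, eps <= mu (f n)].
Proof.
move=> nexh.
have [g [dg [[M gM] [nu [dnu [e [e0 ge]]]]]]] : exists g, disjoint_seq L g /\
    (exists M : R, forall n, `|g n| <= M) /\ exists nu, dual nu /\ exists e : R, 0 < e /\
    forall N, exists n, (N <= n)%N /\ e <= `|nu ⟦g n⟧|.
  apply: contrapT => h; apply: nexh => g dg bg nu dnu e e0.
  apply: contrapT => h2; apply: h; exists g; split=> //; split=> //; exists nu; split=> //.
  exists e; split=> // N; apply: contrapT => h3; apply: h2; exists N => n Nn.
  by rewrite ltNge; apply/negP => h4; apply: h3; exists n.
have [k hk] := choice ge.
(* Each index is chosen strictly beyond the previous one. *)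
pose h := fix h n := if n is m.+1 then k (h m).+1 else k 0%N.
have hinc n : (h n < h n.+1)%N by have [] := hk (h n).+1.
have hlt n m : (n < m)%N -> (h n < h m)%N.
  by apply: (@homo_ltn _ h (fun i j => i < j)%N) => //; exact: ltn_trans.
have hge n : e <= `|nu ⟦g (h n)⟧| by case: n => [|n]; [case: (hk 0%N)|case: (hk (h n).+1)].
have idT : lattice_ideal L (fun=> True) by split.
pose mu := modulus L nu (fun=> True).
have dmu : dual mu by exact: modulus_dual.
have mu0 : dual_le L (fun=> 0) mu by move=> x x0; exact: modulus_ge0.
have mug n : e <= mu ⟦g (h n)⟧.
  by apply: le_trans (hge n) _; apply: modulus_ge_norm => //; exact: babs_ge0.
have g0 n : 0 < `|g (h n)|.
  rewrite normr_gt0; apply/eqP => gn; have := mug n.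
  by rewrite gn babs0 (dual0 dmu) leNgt e0.
have M0 : 0 < M by apply: lt_le_trans (g0 0%N) (gM _).
have pf n : 0 ⊑ `|g (h n)|^-1 *: ⟦g (h n)⟧.
  by apply: bleZ0; [rewrite invr_ge0|exact: babs_ge0].
exists (fun n => `|g (h n)|^-1 *: ⟦g (h n)⟧), mu, (e / M); split=> //.
- move=> n m nm; apply: bdisjoint_scale_abs; rewrite ?invr_ge0//; apply: dg.
  by apply/eqP; move: nm; have [/hlt|/hlt|//] := ltngtP n m; [move/ltn_eqF->|move/gtn_eqF->].
- by move=> n; rewrite normrZ norm_babs gtr0_norm ?invr_gt0// mulVf ?gt_eqF.
- split=> [|n]; first exact: divr_gt0.
  rewrite (dualZ dmu) [X in _ <= X]mulrC; apply: ler_pM.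
  + exact: ltW.
  + by rewrite invr_ge0 ltW.
  + exact: mug.
  + by rewrite lef_pV2 ?posrE.
Qed.

(* [f] spans a copy of l1 complemented by
   [P x = \sum_n (rho n.+1 x - rho n x) / mu (f n) *: f n], with [rho n] the part
   of [mu] carried by the ideal of [f 0], ..., [f n.-1]; the coefficients telescope. *)
Lemma not_exhaustive_projection : ~ aw_boundedly_exhaustive L ->
  exists (f : nat -> V) (P : V -> V) (mu : V -> R) (C : R),
    [/\ disjoint_seq L f /\ in_sphere f, dual mu /\ 0 < C,
        forall (a : R) x y, P (a *: x + y) = a *: P x + P y,
        forall x, `|P x| <= C * mu ⟦x⟧ & forall n, P (f n) = f n].
Proof.
move=> /not_exhaustive_l1 [f [mu [eps [df sf f0 [dmu mu0] [eps0 mueps]]]]].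
have absf n : ⟦f n⟧ = f n by exact: babs_pos.
have iH n : lattice_ideal L (head_ideal L f n) by exact: head_idealP.
pose rho n := modulus L mu (head_ideal L f n).
have drho n : dual (rho n) by exact: modulus_dual.
have rho_ge0 n x : 0 ⊑ x -> 0 <= rho n x by move=> x0; exact: modulus_ge0.
have rho_le n x : 0 ⊑ x -> rho n x <= mu x.
  move=> x0; apply: modulus_le => // y _ yx; apply: (pos_dual_le (L := L)) => //.
  by apply: (ble_trans (babs_ub L _)).
have muf n : 0 < mu (f n) by exact: lt_le_trans eps0 (mueps n).
pose del n x := rho n.+1 x - rho n x.
have ddel n : dual (del n) by exact: dual_sub.
have del_ge0 n : dual_le L (fun=> 0) (del n).
  move=> x x0; rewrite subr_ge0; apply: modulus_subset => // y.
  exact: head_ideal_le.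
(* [rho N] vanishes at [f m] for [N <= m] and equals [mu] there for [N > m], so only the step from
   [m] to [m.+1] sees [f m]. *)
have delf n m : del n (f m) = if n == m then mu (f m) else 0.
  have r0 N : (N <= m)%N -> rho N (f m) = 0 by move=> Nm; rewrite -absf; exact: modulus_head_eq0.
  have r1 N : (m < N)%N -> rho N (f m) = mu (f m).
    by move=> mN; apply: modulus_pos_id => //; rewrite -absf; exact: head_ideal_mem.
  rewrite /del; have [nm|nm|->] := ltngtP n m.
  - by rewrite !r0 ?subrr// ltnW.
  - by rewrite !r1 ?subrr// ltnW.
  - by rewrite r1// r0// subr0.
pose z x n : V := (del n x / mu (f n)) *: f n.
have zn x n : `|z x n| <= eps^-1 * del n ⟦x⟧.
  rewrite normrZ sf mulr1 normrM mulrC [`|_^-1|]gtr0_norm ?invr_gt0//.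
  apply: ler_pM => //; first by rewrite invr_ge0 ltW.
    by rewrite lef_pV2 ?posrE.
  by apply: (pos_dual_abs (L := L)).
(* Telescoping bounds the sum of norms by [eps^-1 * rho N ⟦x⟧], hence independently of [N]. *)
have zs x N : [normed series (z x)] N <= eps^-1 * mu ⟦x⟧.
  apply: (@le_trans _ _ (eps^-1 * rho N ⟦x⟧)); last first.
    by rewrite ler_pM2l ?invr_gt0//; apply: rho_le; exact: babs_ge0.
  apply: (@le_trans _ _ (\sum_(0 <= n < N) eps^-1 * del n ⟦x⟧)).
    by apply: ler_sum => n _; exact: zn.
  rewrite -mulr_sumr telescope_sumr// ler_pM2l ?invr_gt0// gerBl.
  by apply: rho_ge0; exact: babs_ge0.
have cz x : cvgn (series (z x)).
  apply: normed_cvg; apply: nondecreasing_is_cvgn.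
    by apply: nondecreasing_series => n _ _; exact: normr_ge0.
  by exists (eps^-1 * mu ⟦x⟧) => _ [N _ <-]; exact: zs.
exists f, (fun x => limn (series (z x))), mu, eps^-1; split=> //.
- by split=> //; rewrite invr_gt0.
- move=> a x y; apply: (cvg_lim (@norm_hausdorff _ _)).
  have -> : series (z (a *: x + y)) = (a \*: series (z x) + series (z y))%R.
    apply/funext => N; rewrite /series /=.
    transitivity (a *: (\sum_(0 <= n < N) z x n) + \sum_(0 <= n < N) z y n); last by [].
    rewrite scaler_sumr -big_split; apply: eq_bigr => n _ /=.
    by rewrite /z (ddel n).1 scalerA -scalerDl mulrDl mulrA.
  by apply: cvgD; [apply: cvgZr; exact: cz|exact: cz].
- move=> x; have c : (fun N => `|series (z x) N|) @ \oo --> `|limn (series (z x))|.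
    by apply: cvg_norm; exact: cz.
 
rewrite -(cvg_lim (@norm_hausdorff _ _) c); apply: limr_le.
    by apply/cvg_ex; eexists; exact: c.
  near=> N; apply: le_trans (zs x N); exact: ler_norm_sum.
- move=> m; apply: (cvg_lim (@norm_hausdorff _ _)); apply: cvg_near_cst.
  exists m.+1 => // N /= mN; rewrite /series /= (bigD1_seq m) ?iota_uniq//=; last first.
    by rewrite mem_index_iota.
  rewrite big1 ?addr0 => [|n nm]; first by rewrite /z delf eqxx divff ?gt_eqF// scale1r.
  by rewrite /z delf (negbTE nm) mul0r scale0r.
Unshelve. all: by end_near. Qed.

Lemma aw_null_norm_null (I : Type) (le : I -> I -> Prop) (f : I -> V) :
  norm_null le f -> aw_null L le f.
Proof.
move=> nf nu dnu d d0; have [C C0 hC] := dual_bounded dnu.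
have [p0 h] := nf _ (divr_gt0 d0 C0); exists p0 => p /h.
rewrite normr_id ltr_pdivlMr// mulrC => h'.
by apply: le_lt_trans (hC _) _; rewrite norm_babs.
Qed.

Section Complement.
Context (P : V -> V) (mu : V -> R) (C : R).
Hypotheses (dmu : dual mu) (C0 : 0 < C).
Hypothesis linP : forall (a : R) x y, P (a *: x + y) = a *: P x + P y.
Hypothesis PC : forall x, `|P x| <= C * mu ⟦x⟧.

Lemma complement_bounded : exists2 K : R, 0 < K & forall x, `|x - P x| <= K * `|x|.
Proof.
have [D D0 hD] := dual_bounded dmu; exists (1 + C * D).
  by rewrite addr_gt0// mulr_gt0.
move=> x; rewrite mulrDl mul1r; apply: le_trans (ler_normB _ _) _.
rewrite lerD2l; apply: le_trans (PC x) _; rewrite -mulrA ler_pM2l//.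
by apply: le_trans (ler_norm _) _; rewrite -(norm_babs L x).
Qed.

Lemma complement_op : bounded_op (fun x => x - P x).
Proof.
have lT (a : R) x y : a *: x + y - P (a *: x + y) = a *: (x - P x) + (y - P y).
  by rewrite linP scalerBr opprD addrACA.
split=> //; have [K _ hK] := complement_bounded.
exact: (@lipschitz_linear_continuous _ V V _ K).
Qed.

(** A unit vector satisfies [1 <= |f p - P (f p)| + C * mu ⟦f p⟧], and both summands would drop
    below 1/2. *)
Lemma complement_complements : complements_aw L (fun x => x - P x).
Proof.
move=> I le [[i0] [lerefl [letr ledir]]] f sf af nf.
have half : (0 : R) < 1 / 2 by lra.
have [p1 h1] := nf _ half.
have [p2 h2] := af mu dmu _ (divr_gt0 half C0).
have [p [/h1 l1 /h2 l2]] := ledir p1 p2.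
rewrite normr_id in l1; have := ler_normD (f p - P (f p)) (P (f p)).
rewrite subrK sf.
have : C * mu ⟦f p⟧ < 1 / 2.
  by rewrite mulrC -ltr_pdivlMr//; apply: le_lt_trans l2; exact: ler_norm.
have := PC (f p); lra.
Qed.

End Complement.

Lemma DNS_exhaustive :
  (forall (H : completeNormedModType R) (T : V -> H),
     bounded_op T -> complements_aw L T -> DNS L T) -> aw_boundedly_exhaustive L.
Proof.
move=> h; apply: contrapT.
move=> /not_exhaustive_projection [f [P [mu [C [[df sf] [dmu C0] linP PC Pf]]]]].
apply: (h _ _ (complement_op dmu C0 linP PC) (complement_complements dmu C0 PC) f df sf).
under eq_fun do rewrite Pf subrr normr0.
exact: cvg_cst.
Qed.

Lemma closed_span_DNS :
  (forall f : nat -> V, disjoint_seq L f -> (forall n, f n <> 0) ->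
     ~ aw_agrees_norm_on L (closure (lin_span f))) -> aw_boundedly_exhaustive L.
Proof.
move=> h; apply: contrapT.
move=> /not_exhaustive_projection [f [P [mu [C [[df sf] [dmu C0] linP PC Pf]]]]].
apply: (h f df) => [n fn|I le dle g gE].
  by have := sf n; rewrite fn normr0 => /eqP; rewrite eq_sym oner_eq0.
split=> [ag|]; last exact: aw_null_norm_null.
have [K K0 hK] := complement_bounded dmu C0 PC.
have P0 : P 0 = 0.
  by apply/eqP; have := PC 0; rewrite babs0 (dual0 dmu) mulr0 normr_le0.
have Pspan x : lin_span f x -> P x = x.
  move=> [N [c ->]]; elim: N => [|N IH]; first by rewrite big_ord0.
  by rewrite big_ord_recr/= addrC linP Pf IH.
(* [x - P x] vanishes on the span and is bounded in norm by [K * |x|], so it vanishes on the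
   closure. *)
have PE x : closure (lin_span f) x -> P x = x.
  move=> cx; apply/eqP; rewrite eq_sym -subr_eq0 -normr_le0.
  apply/ler_addgt0Pr => d d0; rewrite add0r.
  have [y [/Pspan Py]] := cx _ (nbhsx_ballx x _ (divr_gt0 d0 K0)).
  rewrite -ball_normE /ball_ /= => xy.
  have -> : x - P x = (x - y) - P (x - y).
    have -> : P (x - y) = P x - y.
      by rewrite addrC -scaleN1r linP Py scaleN1r addrC.
    by rewrite opprB addrA subrK.
  by apply: le_trans (hK _) _; rewrite mulrC -ler_pdivlMr// ltW.
move=> d d0; have [p0 hp] := ag mu dmu _ (divr_gt0 d0 C0); exists p0 => p /hp hp'.
rewrite normr_id -(PE _ (gE p)); apply: le_lt_trans (PC _) _.
by rewrite mulrC -ltr_pdivlMr//; apply: le_lt_trans hp'; exact: ler_norm.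
Qed.

End Projection.

(** * Dispersed subspaces, closed spans and the remaining short implications *)

Section Dispersed.
Context {R : realType} {V : completeNormedModType R} (L : banach_lattice V).
Local Notation "⟦ x ⟧" := (babs L x) (at level 0, format "⟦ x ⟧").

Lemma bdisjoint_scale (a b : R) x y : bdisjoint L x y -> bdisjoint L (a *: x) (b *: y).
Proof.
move=> xy; have /bdisjointP := bdisjoint_scale_abs (normr_ge0 a) (normr_ge0 b) xy.
have pos (c : R) z : babs L (`|c| *: ⟦z⟧) = `|c| *: ⟦z⟧.
  by apply: babs_pos; apply: bleZ0 => //; exact: babs_ge0.
rewrite !pos.
by move=> h; apply/bdisjointP; apply: bperp_le h; exact: babsZ.
Qed.

(** Disjoint vectors close to unit vectors of [E] eventually have norm above 1/2. Normalizing them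
    at most doubles the distance, so a normalized disjoint sequence approaches [E]. *)
Lemma inf_dispersed_dispersed (E : set V) : closed_subspace E ->
  inf_dispersed L E -> dispersed L E.
Proof.
move=> [_ [linE _]] [r r0 hr] [e [f [Ee [se [df /cvgr0Pnorm_lt ef]]]]].
have E0 : E 0 by have := linE (-1) _ _ (Ee 0%N) (Ee 0%N); rewrite scaleN1r addNr.
have half : (0 : R) < 1 / 2 by lra.
have [N _ hN] := ef _ half.
have fge n : (N <= n)%N -> 1 / 2 < `|f n|.
  move=> /hN /=; rewrite normr_id => h.
  by have := ler_normD (e n - f n) (f n); rewrite subrK se; lra.
have fgt n : 0 < `|f (N + n)%N| by apply: lt_trans half (fge _ _); rewrite leq_addr.
(* The shift by [N] skips the terms that might vanish. *)
pose g n := `|f (N + n)%N|^-1 *: f (N + n)%N.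
have dg : disjoint_seq L g.
  move=> n m nm; apply: bdisjoint_scale; apply: df => /eqP.
  by rewrite eqn_add2l => /eqP.
have sg : in_sphere g.
  by move=> n; rewrite normrZ gtr0_norm ?invr_gt0// mulVf ?gt_eqF.
apply: (limn_einf_null r0 _ (hr g dg sg)) => d d0.
have [K _ hK] := ef _ (mulr_gt0 d0 half).
exists K => n Kn; have /hK /= : (K <= N + n)%N by rewrite (leq_trans Kn)// leq_addl.
rewrite normr_id => h.
have Eg : E (`|f (N + n)%N|^-1 *: e (N + n)%N).
  by rewrite -[X in E X]addr0; apply: linE.
apply: le_lt_trans (dist_to_le _ Eg) _.
rewrite -scalerBr normrZ gtr0_norm ?invr_gt0// distrC ltr_pdivrMl//.
apply: lt_le_trans h _; rewrite mulrC ler_pM2r//; apply: ltW; apply: fge.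
exact: leq_addr.
Qed.

Lemma lin_span_linear (f : nat -> V) (a : R) x y :
  lin_span f x -> lin_span f y -> lin_span f (a *: x + y).
Proof.
(* Zero padding brings both combinations to a common length. *)
have pad (N M : nat) (c : nat -> R) : (N <= M)%N ->
    \sum_(i < N) c i *: f i = \sum_(i < M) (if (i < N)%N then c i else 0) *: f i.
  move=> NM; rewrite (big_ord_widen _ (fun i => c i *: f i) NM) big_mkcond.
  by apply: eq_bigr => i _; case: ifP => // _; rewrite scale0r.
move=> [N [c ->]] [M [b ->]]; exists (maxn N M).
exists (fun i => a * (if (i < N)%N then c i else 0) + (if (i < M)%N then b i else 0)).
rewrite (pad N _ c (leq_maxl N M)) (pad M _ b (leq_maxr N M)).
rewrite scaler_sumr -big_split; apply: eq_bigr => i _ /=.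
by rewrite scalerA scalerDl.
Qed.

Lemma closure_span_closed_subspace (f : nat -> V) :
  closed_subspace (closure (lin_span f)).
Proof.
split; last split; last exact: closed_closure.
  by apply: subset_closure; exists 0%N, (fun=> 0); rewrite big_ord0.
move=> a x y cx cy B /nbhs_ballP [d /= d0 hB].
(* Adding 1 keeps the divisor positive when [a = 0]. *)
have a0 : 0 < `|a| + 1 by rewrite ltr_wpDl.
have d2 : 0 < d / 2 by lra.
have [x' [Sx]] := cx _ (nbhsx_ballx x _ (divr_gt0 d2 a0)).
have [y' [Sy]] := cy _ (nbhsx_ballx y _ d2).
rewrite -!ball_normE /ball_ /= => hy hx.
exists (a *: x' + y'); split; first exact: lin_span_linear.
apply: hB; rewrite -ball_normE /ball_ /= opprD addrACA -scalerBr.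
apply: le_lt_trans (ler_normD _ _) _; rewrite normrZ.
rewrite ltr_pdivlMr// in hx.
have : `|a| * `|x - x'| <= `|x - x'| * (`|a| + 1) by rewrite mulrDr mulr1 mulrC lerDl.
lra.
Qed.

Lemma lin_span_mem (f : nat -> V) (a : R) n : lin_span f (a *: f n).
Proof.
exists n.+1, (fun i => if i == n then a else 0).
rewrite big_ord_recr /= eqxx big1 ?add0r// => i _.
by rewrite ltn_eqF// scale0r.
Qed.

(** The normalized sequence itself lies in the span and is disjoint, so it plays both roles. *)
Lemma span_not_dispersed (f : nat -> V) : disjoint_seq L f -> (forall n, f n <> 0) ->
  ~ dispersed L (closure (lin_span f)).
Proof.
move=> df f0; apply.
exists (fun n => `|f n|^-1 *: f n), (fun n => `|f n|^-1 *: f n); split.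
  by move=> n; apply: subset_closure; exact: lin_span_mem.
split.
  move=> n; have fn : 0 < `|f n| by rewrite normr_gt0; apply/eqP.
  by rewrite normrZ gtr0_norm ?invr_gt0// mulVf ?gt_eqF.
split; first by move=> n m nm; apply: bdisjoint_scale; exact: df.
under eq_fun do rewrite subrr normr0.
exact: cvg_cst.
Qed.

(** Order continuity of the dual norm puts every functional into [dual_a]. *)
Lemma order_continuous_aw_eq_aaw : dual_order_continuous L -> aw_eq_aaw L.
Proof.
move=> oc I le _ f; split=> af nu; first by move=> [dnu _]; exact: af.
by move=> dnu; apply: af; split=> // D D1 D2 _; exact: oc.
Qed.

Lemma aw_eq_aaw_exhaustive : aw_eq_aaw L -> aw_boundedly_exhaustive L.
Proof.
move=> eq f df bf; apply/eq.
  split; first exact: inhabits 0%N.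
  split; first exact: leqnn.
  split; first by move=> p q s; exact: leq_trans.
  by move=> p q; exists (maxn p q); rewrite leq_maxl leq_maxr.
by move=> nu dnu; exact: dual_a_disjoint_null.
Qed.

Lemma inf_DNS_DNS (H : completeNormedModType R) (T : V -> H) :
  inf_DNS L T -> DNS L T.
Proof.
move=> [r r0 hr] f df sf /cvgr0Pnorm_lt Tf.
apply: (limn_einf_null r0 _ (hr f df sf)) => d /Tf [N _ hN].
by exists N => n /hN /=; rewrite normr_id.
Qed.

End Dispersed.

(** * The eight conditions closed into one cycle of implications *)

Theorem mainTheorem5 (R : realType) (V : completeNormedModType R)
    (L : banach_lattice V) :
  [<->
   (* (i) *)   dual_order_continuous L;
   (* (ii) *)  aw_eq_aaw L;
   (* (iii) *) aw_boundedly_exhaustive L;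
   (* (iv) *)  (forall (H : completeNormedModType R) (T : V -> H),
                  bounded_op T -> complements_aw L T -> inf_DNS L T);
   (* (iv') *) (forall (H : completeNormedModType R) (T : V -> H),
                  bounded_op T -> complements_aw L T -> DNS L T);
   (* (v) *)   (forall E : set V, closed_subspace E ->
                  aw_agrees_norm_on L E -> inf_dispersed L E);
   (* (v') *)  (forall E : set V, closed_subspace E ->
                  aw_agrees_norm_on L E -> dispersed L E);
   (* (vi) *)  (forall f : nat -> V, disjoint_seq L f -> (forall n, f n <> 0) ->
                  ~ aw_agrees_norm_on L (closure (lin_span f)))].
Proof.
tfae.
- exact: order_continuous_aw_eq_aaw.
- exact: aw_eq_aaw_exhaustive.
- exact: exhaustive_inf_DNS.
- by move=> h H T bT cT; apply: inf_DNS_DNS; exact: h.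
- by move=> /DNS_exhaustive; exact: exhaustive_inf_dispersed.
- by move=> h E cE aE; apply: inf_dispersed_dispersed => //; exact: h.
- move=> h f df f0 aE; apply: (span_not_dispersed df f0); apply: h => //.
  exact: closure_span_closed_subspace.
- by move=> /closed_span_DNS; exact: exhaustive_order_continuous.
Qed.
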